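(* Let $q$ be an odd prime power, let $2 \le m < k$ be integers and let $L$ be an irredundant $(m \times k)$-system over $\mathbb{F}_q$. If $L$ induces a $(2 \times 4)$-system, then $L$ is uncommon.
   Context: A system $L$ of $m$ linear forms $L_1,\dots,L_m$ in $k$ variables with coefficients in $\mathbb{F}_q$ is identified with its $m\times k$ coefficient matrix; it is an $(m\times k)$-system if the rows of this matrix are linearly independent over $\mathbb{F}_q$. For $A\subseteq \mathbb{F}_q^n$, $\mathrm{sol}(L;A)=\{\mathbf{x}=(x_1,\dots,x_k)\in A^k : L\mathbf{x}^T=0\}$ (each $x_i\in\mathbb{F}_q^n$, the equations applied coordinatewise). For an $\ell$-variable system $L'$, $L$ induces $L'$ (as a subsystem) if there is a subset $\{i_1,\dots,i_\ell\}\subseteq[k]$ such that for every $\mathbf{x}\in\mathbb{F}_q^k$, $L(x_1,\dots,x_k)=0$ implies $L'(x_{i_1},\dots,x_{i_\ell})=0$. $L$ is redundant if it induces the equation $x_i-x_j=0$ for some $i\neq j$, and irredundant otherwise. For $f:\mathbb{F}_q^n\to\mathbb{R}$ let $\Lambda_L(f)=\frac{1}{|\mathrm{sol}(L;\mathbb{F}_q^n)|}\sum_{\mathbf{x}\in\mathrm{sol}(L;\mathbb{F}_q^n)} f(x_1)\cdots f(x_k)$ and $\Delta_L(f)=\Lambda_L(1/2+f)+\Lambda_L(1/2-f)$. A $k$-variable system $L$ is common if for every $n\ge1$ and every $f:\mathbb{F}_q^n\to[-1/2,1/2]$ we have $\Delta_L(f)\ge 2^{1-k}$ (for irredundant $L$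 this is equivalent to: in every two-colouring of $\mathbb{F}_q^n$ the number of monochromatic solutions to $L=0$ is asymptotically at least the expected number in a uniformly random two-colouring); otherwise $L$ is uncommon. *)

(* Defs.v *)
From HB Require Import structures.
From mathcomp Require Import all_boot all_order all_algebra.
From mathcomp Require Import reals.

Set Implicit Arguments.
Unset Strict Implicit.
Unset Printing Implicit Defensive.

Import Order.TTheory GRing.Theory Num.Theory.
Local Open Scope ring_scope.

Definition is_system (F : finFieldType) (m k : nat) (L : 'M[F]_(m, k)) : bool :=
  row_free L.

(* A k-tuple (x_1, ..., x_k) of vectors of F^n is encoded as the k x n matrix X
   whose i-th row is x_i, so that L *m X = 0 says that the equations of L hold
   in each of the n coordinates. *)
Definition sol (F : finFieldType) (m k n : nat) (L : 'M[F]_(m, k))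
    (A : {set 'rV[F]_n}) : {set 'M[F]_(k, n)} :=
  [set X : 'M[F]_(k, n) | [forall i, row i X \in A] && (L *m X == 0)].

(* The injection s lists the distinct indices i_1, ..., i_l. *)
Definition induces (F : finFieldType) (m k m' l : nat)
    (L : 'M[F]_(m, k)) (L' : 'M[F]_(m', l)) : Prop :=
  exists2 s : 'I_l -> 'I_k, injective s &
    forall x : 'cV[F]_k, L *m x = 0 -> L' *m (\col_j x (s j) 0) = 0.

Definition redundant (F : finFieldType) (m k : nat) (L : 'M[F]_(m, k)) : Prop :=
  exists i j : 'I_k, i <> j /\
    forall x : 'cV[F]_k, L *m x = 0 -> x i 0 - x j 0 = 0.

Definition irredundant (F : finFieldType) (m k : nat) (L : 'M[F]_(m, k)) : Prop :=
  ~ redundant L.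

Definition Lambda (R : realType) (F : finFieldType) (m k n : nat)
    (L : 'M[F]_(m, k)) (f : 'rV[F]_n -> R) : R :=
  #|sol L [set: 'rV[F]_n]|%:R^-1 *
    \sum_(X in sol L [set: 'rV[F]_n]) \prod_(i < k) f (row i X).

Definition Delta (R : realType) (F : finFieldType) (m k n : nat)
    (L : 'M[F]_(m, k)) (f : 'rV[F]_n -> R) : R :=
  Lambda L (fun v => 1 / 2 + f v) + Lambda L (fun v => 1 / 2 - f v).

Definition common (R : realType) (F : finFieldType) (m k : nat)
    (L : 'M[F]_(m, k)) : Prop :=
  forall n : nat, (1 <= n)%N ->
  forall f : 'rV[F]_n -> R, (forall v, - (1 / 2) <= f v <= 1 / 2) ->
    (2 : R) ^ (1 - k%:Z) <= Delta L f.

Definition uncommon (R : realType) (F : finFieldType) (m k : nat)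
    (L : 'M[F]_(m, k)) : Prop :=
  ~ common R L.

(* Main.v *)
(** Expanding the product, [Delta L (e g) - 2^(1-k)] is a combination with positive
    weights of the moments [E (prod_(i in S) g (x_i))], scaled by [e^|S|], over
    nonempty sets [S] of even size, so for small [e] its sign is that of the sum
    of the moments of lowest order.

    If some variable is forced to vanish, or two variables are proportional on
    the solution space, then a function on [F] already makes the sum over pairs
    negative. Otherwise any two variables are independent, and pairs contribute
    nothing as soon as [g] has mean zero. Then, for [g] of small support in a
    huge space, the sum over 4-element sets is dominated by the [S] on which the
    solution space has dimension 2, such as the given (2 x 4)-subsystem.

    On the latter, write [x_2 = a x_0 + b x_1] and [x_3 = c x_0 + d x_1]. With
    [e_i], [f_j], [g_l] unit vectors in three separate blocks of coordinates, take
    the triangle configuration [x_0 = (e_i - f_j)/a], [x_1 = (f_j - g_l)/b],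
    [x_2 = e_i - g_l], and the resulting [x_3]. It yields [r^3] solutions although
    the first three families have only [r^2] members. Give these families weight 1
    and the fourth a small negative weight [-c]; a fifth family, outside the plane
    of the others, restores mean zero. Within the support the only other solutions
    of any 2-dimensional 4-variable subsystem are constant, or also have one point
    in each of the first four families and so contribute negatively. The constant
    ones contribute [O(r^2 + c^4 r^3)], less than the gain [c r^3]. *)

Require Import Defs.
From HB Require Import structures.
From mathcomp Require Import all_boot all_order all_algebra.
From mathcomp Require Import reals.
From mathcomp Require Import ring lra zify.

Set Implicit Arguments.
Unset Strict Implicit.
Unset Printing Implicit Defensive.

Import Order.TTheory GRing.Theory Num.Theory.
Local Open Scope ring_scope.

(** * Expansion of [Delta] into moments *)

Definition avg (R : realType) (T : finType) (P : {set T}) (F : T -> R) : R :=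
  #|P|%:R^-1 * \sum_(x in P) F x.

Definition moment (R : realType) (F : finFieldType) (m k n : nat)
    (L : 'M[F]_(m, k)) (f : 'rV[F]_n -> R) (S : {set 'I_k}) : R :=
  avg (sol L [set: 'rV[F]_n]) (fun X => \prod_(i in S) f (row i X)).

Lemma in_sol (F : finFieldType) (m k n : nat) (L : 'M[F]_(m, k)) (X : 'M_(k, n)) :
  (X \in sol L [set: 'rV[F]_n]) = (L *m X == 0).
Proof.
by rewrite inE; case: forallP => //= h; case: h => i; rewrite inE.
Qed.

Lemma card_sol_gt0 (F : finFieldType) (m k n : nat) (L : 'M[F]_(m, k)) :
  (0 < #|sol L [set: 'rV[F]_n]|)%N.
Proof. by apply/card_gt0P; exists 0; rewrite in_sol mulmx0. Qed.

Lemma avg_le (R : realType) (T : finType) (P : {set T}) (F G : T -> R) :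
  (forall x, x \in P -> F x <= G x) -> avg P F <= avg P G.
Proof. by move=> h; rewrite ler_wpM2l ?invr_ge0 ?ler0n // ler_sum. Qed.

Lemma moment_scale (R : realType) (F : finFieldType) (m k n : nat)
    (L : 'M[F]_(m, k)) (f : 'rV[F]_n -> R) (e : R) (S : {set 'I_k}) :
  moment L (fun v => e * f v) S = e ^+ #|S| * moment L f S.
Proof.
rewrite /moment /avg [RHS]mulrCA; congr (_ * _); rewrite mulr_sumr.
by apply: eq_bigr => X _; rewrite big_split /= prodr_const.
Qed.

Lemma moment_set0 (R : realType) (F : finFieldType) (m k n : nat)
    (L : 'M[F]_(m, k)) (f : 'rV[F]_n -> R) : moment L f set0 = 1.
Proof.
rewrite /moment /avg (eq_bigr (fun=> 1)) => [|X _]; last by rewrite big_set0.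
by rewrite sumr_const mulVf // pnatr_eq0 -lt0n card_sol_gt0.
Qed.

(** Multiply out: [S] collects the indices where [f] is taken, and every other index contributes
    [1 / 2]. *)
Lemma Lambda_expand (R : realType) (F : finFieldType) (m k n : nat)
    (L : 'M[F]_(m, k)) (f : 'rV[F]_n -> R) :
  Lambda L (fun v => 1 / 2 + f v) =
  2 ^- k * \sum_(S : {set 'I_k}) 2 ^+ #|S| * moment L f S.
Proof.
rewrite /Lambda.
rewrite (eq_bigr (fun X => \sum_(S : {set 'I_k})
    2 ^- k * (2 ^+ #|S| * \prod_(i in S) f (row i X)))); last first.
  move=> X _; under eq_bigr do rewrite addrC.
  rewrite bigA_distr; apply: eq_bigr => S _.
  rewrite (bigID (mem S)) /=.
  rewrite (eq_bigr (fun i => f (row i X))) => [|i ->] //.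
  rewrite [X in _ * X](eq_bigr (fun=> 2^-1)) => [|i /negPf ->]; last by rewrite div1r.
  have -> : \prod_(i | i \notin S) 2^-1 = 2^-1 ^+ #|~: S| :> R.
    by rewrite -prodr_const; apply: eq_bigl => i; rewrite inE.
  have -> : 2 ^+ k = 2 ^+ #|S| * 2 ^+ #|~: S| :> R.
    by rewrite -exprD cardsC card_ord.
  rewrite exprVn invfM mulrA mulrC; congr (_ * _).
  by rewrite mulrAC mulVf ?mul1r // expf_neq0 // pnatr_eq0.
rewrite exchange_big /= mulr_sumr mulr_sumr; apply: eq_bigr => S _.
by rewrite /moment /avg -!mulr_sumr; ring.
Qed.

(** The two halves of [Delta] are expansions at [e] and [- e], so odd orders cancel, which
    [1 + (-1) ^+ i] records. *)
Lemma Delta_scale (R : realType) (F : finFieldType) (m k n : nat)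
    (L : 'M[F]_(m, k)) (g : 'rV[F]_n -> R) (e : R) :
  Delta L (fun v => e * g v) =
  2 ^- k * \sum_(i < k.+1) (1 + (-1) ^+ i) * (2 * e) ^+ i *
    \sum_(S : {set 'I_k} | #|S| == i) moment L g S.
Proof.
have -> : Delta L (fun v => e * g v) =
    Lambda L (fun v => 1 / 2 + e * g v) + Lambda L (fun v => 1 / 2 + (- e) * g v).
  rewrite /Delta; congr (_ + _); rewrite /Lambda; congr (_ * _).
  by apply: eq_bigr => X _; apply: eq_bigr => i _; rewrite mulNr.
rewrite !Lambda_expand -mulrDr -big_split /=; congr (_ * _).
rewrite (partition_big (fun S : {set 'I_k} => inord #|S| : 'I_k.+1) xpredT) //=.
apply: eq_bigr => i _; rewrite mulr_sumr.
have card_eq (S : {set 'I_k}) : ((inord #|S| : 'I_k.+1) == i) = (#|S| == i).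
  have cS : (#|S| < k.+1)%N by have := max_card (mem S); rewrite card_ord.
  by rewrite -val_eqE /= (inordK cS).
apply: eq_big => [S|S]; first exact: card_eq.
rewrite card_eq !moment_scale => /eqP ->.
by rewrite exprMn [in (- e) ^+ _]exprNn; ring.
Qed.

(* For a small multiple of [g] the lowest-order term of [Delta] dominates. *)
Lemma uncommon_of_moments (R : realType) (F : finFieldType) (m k n j : nat)
    (L : 'M[F]_(m, k)) (g : 'rV[F]_n -> R) :
  (0 < n)%N -> (0 < j)%N -> ~~ odd j ->
  (forall i, (0 < i < j)%N -> ~~ odd i ->
     \sum_(S : {set 'I_k} | #|S| == i) moment L g S = 0) ->
  \sum_(S : {set 'I_k} | #|S| == j) moment L g S < 0 ->
  uncommon R L.
Proof.
move=> n_gt0 j_gt0 even_j low_moments neg_moment common_L.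
pose a i := \sum_(S : {set 'I_k} | #|S| == i) moment L g S.
(* [b i] is the coefficient of [e ^+ i] in [2 ^+ k] times [Delta] at [e * g]; [b 0 = 2] accounts
   exactly for the bound [2 ^ (1 - k)]. *)
pose b i := (1 + (-1) ^+ i) * 2 ^+ i * a i.
pose M := 1 + \sum_v `|g v|.
pose Q := 1 + \sum_(i < k.+1) `|b i|.
have M_ge1 : 1 <= M by rewrite lerDl sumr_ge0.
have Q_ge1 : 1 <= Q by rewrite lerDl sumr_ge0.
have g_le v : `|g v| <= M.
  by rewrite /M (bigD1 v) //= addrCA lerDl addr_ge0 // sumr_ge0.
have j_le : (j <= k)%N.
  rewrite leqNgt; apply/negP => k_lt; move: neg_moment.
  rewrite big1 ?ltxx // => S /eqP cS; move: (max_card (mem S)).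
  by rewrite cS card_ord leqNgt k_lt.
have bj_lt0 : b j < 0.
  rewrite /b -signr_odd (negPf even_j) expr0 pmulr_rlt0 //.
  by apply: mulr_gt0; [lra|apply: exprn_gt0; lra].
have a0 : a 0%N = 1.
  rewrite /a (big_pred1 set0) ?moment_set0 // => S.
  by rewrite cards_eq0.
have b_small i : (0 < i < j)%N -> b i = 0.
  move=> ij; rewrite /b; case: (boolP (odd i)) => oi.
    by rewrite -signr_odd oi expr1 subrr !mul0r.
  by rewrite /a low_moments // mulr0.
(* This is commonness at [e * g] with the constant term removed, divided by [e ^+ j]. As [e <= 1],
   the orders above [j] contribute at most [e * Q]. *)
have dom e : 0 < e -> e <= 1 -> e * M <= 1 / 2 -> 0 <= b j + e * Q.
  move=> e_gt0 e_le1 eM.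
  have bounded v : - (1 / 2) <= e * g v <= 1 / 2.
    rewrite -ler_norml normrM gtr0_norm //.
    by apply: le_trans eM; rewrite ler_pM2l.
  have := common_L n n_gt0 _ bounded.
  rewrite Delta_scale expfzDr ?pnatr_eq0 // expr1z -exprnN mulrC.
  rewrite ler_pM2l ?invr_gt0 ?exprn_gt0 ?ltr0n // big_ord_recl /=.
  rewrite -/(a 0%N) a0 !expr0 !mulr1 lerDl.
  have -> : \sum_(i < k) (1 + (-1) ^+ bump 0 i) * (2 * e) ^+ bump 0 i *
      (\sum_(S : {set 'I_k} | #|S| == bump 0 i) moment L g S) =
      \sum_(i < k) b i.+1 * e ^+ i.+1.
    by apply: eq_bigr => i _; rewrite /b exprMn -/(a i.+1); ring.
  have jk : (j.-1 < k)%N by rewrite prednK.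
  rewrite (bigD1 (Ordinal jk)) //= prednK // => pos.
  rewrite -(pmulr_rge0 _ (exprn_gt0 j e_gt0)) mulrDr [e ^+ j * b j]mulrC.
  apply: le_trans pos _; rewrite lerD2l.
  rewrite mulrA -exprSr /Q mulrDr mulr1 big_ord_recl /=.
  rewrite mulrDr addrA [leRHS]addrC -[leLHS]addr0 lerD //; last first.
    by rewrite addr_ge0 ?mulr_ge0 // exprn_ge0 // ltW.
  rewrite mulr_sumr big_mkcond; apply: ler_sum => i _.
  case: ifP => [ij|_]; last by rewrite mulr_ge0 // exprn_ge0 // ltW.
  have [i_lt|i_ge] := ltnP i.+1 j.
    by rewrite b_small ?mul0r ?mulr_ge0 ?exprn_ge0 // ltW.
  have ji : (j < i.+1)%N.
    rewrite ltn_neqAle i_ge andbT; apply: contraNneq ij => ji.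
    by rewrite -val_eqE /= ji.
  rewrite mulrC; apply: (le_trans (ler_norm _)).
  rewrite normrM ger0_norm ?exprn_ge0 ?(ltW e_gt0) // ler_wpM2r //.
  by rewrite ler_wiXn2l // ltW.
(* The first bound keeps [e * g] in the allowed range, the second makes [e * Q] at most half of
   [- b j]. *)
pose e := Num.min (1 / (2 * M)) (- b j / (2 * Q)).
have M_gt0 : 0 < M by lra.
have Q_gt0 : 0 < Q by lra.
have e_gt0 : 0 < e.
  by rewrite lt_min !divr_gt0 ?mulr_gt0 ?oppr_gt0 ?ltr0n.
have eM : e * M <= 1 / 2.
  have : e <= 1 / (2 * M) by rewrite ge_min lexx.
  by rewrite ler_pdivlMr ?mulr_gt0 ?ltr0n //; lra.
have eQ : e * Q <= - b j / 2.
  have : e <= - b j / (2 * Q) by rewrite ge_min lexx orbT.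
  by rewrite ler_pdivlMr ?mulr_gt0 ?ltr0n //; lra.
have e_le1 : e <= 1 by nra.
by have := dom e e_gt0 e_le1 eM; lra.
Qed.

(** * Averages over independent variables *)

(** All fibres of [ob] have the same size, so the image of a uniform element of [P] is uniform on
    [D]. *)
Lemma avg_equidistributed (R : realType) (T D : finType) (P : {set T})
    (ob : T -> D) (c : nat) (F : D -> R) :
  (0 < #|P|)%N -> (forall d, #|[set x in P | ob x == d]| = c) ->
  avg P (fun x => F (ob x)) = avg [set: D] F.
Proof.
move=> P_gt0 fiber.
have sumP (G : D -> R) : \sum_(x in P) G (ob x) = c%:R * \sum_d G d.
  rewrite (partition_big ob xpredT) //= mulr_sumr; apply: eq_bigr => d _.
  rewrite (eq_bigr (fun=> G d)) => [|x /andP[_ /eqP ->]] //.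
  rewrite mulr_natl -(fiber d) -sumr_const.
  by apply: eq_bigl => x; rewrite inE.
have cardP : #|P|%:R = c%:R * #|[set: D]|%:R :> R.
  rewrite -[#|P|]sum1_card natr_sum (sumP (fun=> 1)) cardsT.
  by rewrite sumr_const.
have : #|P|%:R != 0 :> R by rewrite pnatr_eq0 -lt0n.
rewrite /avg sumP cardP mulf_eq0 negb_or => /andP[c_neq0 _].
rewrite invfM mulrACA mulVf // mul1r; congr (_ * _).
by apply: eq_bigl => d; rewrite inE.
Qed.

(** Existence of dual vectors means that a solution can take arbitrary prescribed values at the
    variables [s t]. *)
Definition independent (F : finFieldType) (m k u : nat) (L : 'M[F]_(m, k))
    (s : 'I_u -> 'I_k) : Prop :=
  forall t, exists2 a : 'cV[F]_k, L *m a = 0 &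
    forall t', a (s t') 0 = (t' == t)%:R.

Lemma sum_prod_rows (R : realType) (F : finFieldType) (u n : nat)
    (f : 'I_u -> 'rV[F]_n -> R) :
  \sum_(Y : 'M[F]_(u, n)) \prod_t f t (row t Y) = \prod_t \sum_v f t v.
Proof.
pose rows (h : {ffun 'I_u -> 'rV[F]_n}) : 'M[F]_(u, n) := \matrix_t h t.
have rows_bij : bijective rows.
  exists (fun Y => [ffun t => row t Y]) => [h|Y].
    by apply/ffunP => t; rewrite ffunE rowK.
  by apply/row_matrixP => t; rewrite rowK ffunE.
rewrite bigA_distr_bigA (reindex rows); last exact: onW_bij.
by apply: eq_bigr => h _; apply: eq_bigr => t _; rewrite rowK.
Qed.

(** The rows [s t] of a random solution are jointly uniform: with the dual vectors as columns of
    [K], adding [K *m Y] carries the fibre over 0 onto the fibre over [Y]. *)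
Lemma avg_independent (R : realType) (F : finFieldType) (m k u n : nat)
    (L : 'M[F]_(m, k)) (s : 'I_u -> 'I_k) (f : 'I_u -> 'rV[F]_n -> R) :
  independent L s ->
  avg (sol L [set: 'rV[F]_n]) (fun X => \prod_t f t (row (s t) X)) =
  \prod_t avg [set: 'rV[F]_n] (f t).
Proof.
move=> /fin_all_exists2[a La a_s].
pose K : 'M[F]_(k, u) := \matrix_(i, t) a t i 0.
have LK : L *m K = 0.
  apply/matrixP => i t; rewrite !mxE.
  have /matrixP/(_ i 0) := La t; rewrite !mxE => La_i; rewrite -[RHS]La_i.
  by apply: eq_bigr => j _; rewrite mxE.
have sK : rowsub s K = 1%:M.
  by apply/matrixP => t t'; rewrite !mxE a_s.
pose Z := [set X in sol L [set: 'rV[F]_n] | rowsub s X == 0].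
have fiber (Y : 'M[F]_(u, n)) :
    #|[set X in sol L [set: 'rV[F]_n] | rowsub s X == Y]| = #|Z|.
  have inj : injective (fun X : 'M[F]_(k, n) => X + K *m Y) by apply: addIr.
  rewrite -(card_imset (mem Z) inj); apply: eq_card => X.
  apply/idP/imsetP => [|[X' XZ ->]].
    rewrite in_set => /andP[solX /eqP sX].
    exists (X - K *m Y); last by rewrite subrK.
    rewrite in_set in_sol mulmxBr mulmxA LK mul0mx subr0 -in_sol solX /=.
    by rewrite linearB /= -mul_rowsub_mx sK mul1mx sX subrr.
  move: (XZ : X' \in Z); rewrite /Z in_set => /andP[solX /eqP sX].
  rewrite in_set in_sol mulmxDr mulmxA LK mul0mx addr0 -in_sol solX /=.
  by rewrite linearD /= -mul_rowsub_mx sK mul1mx sX add0r.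
transitivity (avg [set: 'M[F]_(u, n)] (fun Y => \prod_t f t (row t Y))).
  rewrite -(avg_equidistributed _ (card_sol_gt0 n L) fiber) /avg.
  congr (_ * _); apply: eq_bigr => X _; apply: eq_bigr => t _.
  by rewrite row_rowsub.
rewrite /avg big_split /= prodr_const card_ord; congr (_ * _).
  rewrite exprVn -natrX; congr (_%:R^-1).
  by rewrite !cardsT !card_mx mul1n mulnC expnM.
rewrite (eq_bigl xpredT) => [|Y]; last by rewrite inE.
rewrite sum_prod_rows; apply: eq_bigr => t _.
by apply: eq_bigl => v; rewrite inE.
Qed.

Definition single_index (k : nat) (i : 'I_k) : 'I_1 -> 'I_k := fun=> i.

Definition pair_index (k : nat) (i j : 'I_k) : 'I_2 -> 'I_k := fun t => nth i [:: i; j] t.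

Definition triple_index (k : nat) (i j l : 'I_k) : 'I_3 -> 'I_k :=
  fun t => nth i [:: i; j; l] t.

Definition zero_var (F : finFieldType) (m k : nat) (L : 'M[F]_(m, k)) (i : 'I_k) :=
  [forall x : 'cV[F]_k, (L *m x == 0) ==> (x i 0 == 0)].

Definition proportional (F : finFieldType) (m k : nat) (L : 'M[F]_(m, k))
    (i j : 'I_k) (c : F) :=
  [forall x : 'cV[F]_k, (L *m x == 0) ==> (x j 0 == c * x i 0)].

(** Normalise a solution [a0] to be 1 at [i]. A solution violating the proportionality with ratio
    [a0 j 0], minus a multiple of [a0], vanishes at [i] but not at [j]; it then serves to clear
    entry [j] of [a0]. *)
Lemma pair_independent (F : finFieldType) (m k : nat) (L : 'M[F]_(m, k)) (i j : 'I_k) :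
  ~~ zero_var L i -> (forall c, ~~ proportional L i j c) ->
  independent L (pair_index i j).
Proof.
rewrite negb_forall => /existsP[x]; rewrite negb_imply => /andP[/eqP Lx xi] nprop.
have [a0 La0 a0i] : exists2 a0 : 'cV[F]_k, L *m a0 = 0 & a0 i 0 = 1.
  by exists ((x i 0)^-1 *: x); rewrite ?mxE ?mulVf // -scalemxAr Lx scaler0.
have := nprop (a0 j 0); rewrite negb_forall => /existsP[y].
rewrite negb_imply => /andP[/eqP Ly yj].
have [b Lb [bi bj]] : exists2 b : 'cV[F]_k, L *m b = 0 & b i 0 = 0 /\ b j 0 = 1.
  exists ((y j 0 - a0 j 0 * y i 0)^-1 *: (y - y i 0 *: a0)).
    by rewrite -scalemxAr mulmxBr -scalemxAr La0 Ly scaler0 subr0 scaler0.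
  rewrite !mxE a0i mulr1 subrr mulr0 [y i 0 * _]mulrC mulVf //.
  by rewrite subr_eq0.
case=> [[|[|//]] ?].
  exists (a0 - a0 j 0 *: b); first by rewrite mulmxBr -scalemxAr La0 Lb scaler0 subr0.
  case=> [[|[|//]] ?]; rewrite /pair_index /= !mxE.
    by rewrite a0i bi mulr0 subr0.
  by rewrite bj mulr1 subrr.
by exists b => //; case=> [[|[|//]] ?]; rewrite /pair_index /=.
Qed.

Lemma single_independent (F : finFieldType) (m k : nat) (L : 'M[F]_(m, k)) (i : 'I_k) :
  ~~ zero_var L i -> independent L (single_index i).
Proof.
rewrite negb_forall => /existsP[x]; rewrite negb_imply => /andP[/eqP Lx xi] t.
exists ((x i 0)^-1 *: x) => [|t']; first by rewrite -scalemxAr Lx scaler0.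
by rewrite mxE mulVf // !ord1.
Qed.

Lemma sol_col (F : finFieldType) (m k n : nat) (L : 'M[F]_(m, k)) (X : 'M[F]_(k, n)) t :
  X \in sol L [set: 'rV[F]_n] -> L *m col t X = 0.
Proof. by rewrite in_sol => /eqP LX; rewrite colE mulmxA LX mul0mx. Qed.

Lemma zero_var_row (F : finFieldType) (m k n : nat) (L : 'M[F]_(m, k)) (i : 'I_k)
    (X : 'M[F]_(k, n)) :
  zero_var L i -> X \in sol L [set: 'rV[F]_n] -> row i X = 0.
Proof.
move=> /forallP Li solX; apply/rowP => t.
have /implyP/(_ _)/eqP := Li (col t X); rewrite sol_col // !mxE; exact.
Qed.

Lemma proportional_row (F : finFieldType) (m k n : nat) (L : 'M[F]_(m, k)) (i j : 'I_k)
    (c : F) (X : 'M[F]_(k, n)) :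
  proportional L i j c -> X \in sol L [set: 'rV[F]_n] -> row j X = c *: row i X.
Proof.
move=> /forallP Lij solX; apply/rowP => t.
have /implyP/(_ _)/eqP := Lij (col t X); rewrite sol_col // !mxE; exact.
Qed.

Lemma irredundant_proportional (F : finFieldType) (m k : nat) (L : 'M[F]_(m, k))
    (i j : 'I_k) (c : F) :
  irredundant L -> i != j -> proportional L i j c -> c != 1.
Proof.
move=> irr /eqP ij /forallP prop; apply/eqP => c1; apply: irr.
exists i, j; split => // x Lx.
by have := prop x; rewrite Lx eqxx c1 mul1r => /eqP ->; rewrite subrr.
Qed.

Lemma irredundant_zero_var (F : finFieldType) (m k : nat) (L : 'M[F]_(m, k))
    (i j : 'I_k) : irredundant L -> i != j -> zero_var L i -> ~~ zero_var L j.
Proof.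
move=> irr /eqP ij /forallP zi; apply/negP => /forallP zj; apply: irr.
exists i, j; split => // x Lx.
by have := zi x; have := zj x; rewrite Lx eqxx => /eqP -> /eqP ->; rewrite subrr.
Qed.

Lemma moment_pair (R : realType) (F : finFieldType) (m k n : nat)
    (L : 'M[F]_(m, k)) (f : 'rV[F]_n -> R) (i j : 'I_k) :
  i != j -> moment L f [set i; j] =
  avg (sol L [set: 'rV[F]_n]) (fun X => f (row i X) * f (row j X)).
Proof.
move=> ij; rewrite /moment /avg; congr (_ * _); apply: eq_bigr => X _.
by rewrite big_setU1 ?big_set1 // inE.
Qed.

Lemma avg_pair (R : realType) (F : finFieldType) (m k n : nat)
    (L : 'M[F]_(m, k)) (f g : 'rV[F]_n -> R) (i j : 'I_k) :
  independent L (pair_index i j) ->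
  avg (sol L [set: 'rV[F]_n]) (fun X => f (row i X) * g (row j X)) =
  avg [set: 'rV[F]_n] f * avg [set: 'rV[F]_n] g.
Proof.
move=> /(avg_independent (fun t => if t == ord0 then f else g)).
rewrite !big_ord_recl big_ord0 mulr1 /= => <-.
by congr (_ * _); apply: eq_bigr => X _; rewrite !big_ord_recl big_ord0 mulr1.
Qed.

Lemma avg_triple (R : realType) (F : finFieldType) (m k n : nat)
    (L : 'M[F]_(m, k)) (f : 'rV[F]_n -> R) (i j l : 'I_k) :
  independent L (triple_index i j l) ->
  avg (sol L [set: 'rV[F]_n]) (fun X => f (row i X) * f (row j X) * f (row l X)) =
  avg [set: 'rV[F]_n] f ^+ 3.
Proof.
move=> /(avg_independent (fun=> f)); rewrite prodr_const card_ord => <-.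
congr (_ * _); apply: eq_bigr => X _.
by rewrite !big_ord_recl big_ord0 mulr1 mulrA.
Qed.

Lemma moment_pair_independent (R : realType) (F : finFieldType) (m k n : nat)
    (L : 'M[F]_(m, k)) (f : 'rV[F]_n -> R) (i j : 'I_k) :
  i != j -> independent L (pair_index i j) ->
  moment L f [set i; j] = avg [set: 'rV[F]_n] f ^+ 2.
Proof. by move=> ij ind; rewrite moment_pair // avg_pair. Qed.

(** * Degenerate systems *)

Lemma avg_lt0 (R : realType) (T : finType) (P : {set T}) (F : T -> R) (x : T) :
  (forall y, y \in P -> F y <= 0) -> x \in P -> F x < 0 -> avg P F < 0.
Proof.
move=> F_le0 xP Fx_lt0.
have P_gt0 : (0 < #|P|)%N by apply/card_gt0P; exists x.
rewrite pmulr_rlt0 ?invr_gt0 ?ltr0n // (bigD1 x) //=.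
by rewrite ltr_wnDr // sumr_le0 // => y /andP[/F_le0].
Qed.

Lemma proportional0 (F : finFieldType) (m k : nat) (L : 'M[F]_(m, k)) (i j : 'I_k) :
  proportional L i j 0 -> zero_var L j.
Proof. by move=> /forallP h; apply/forallP => x; have := h x; rewrite mul0r. Qed.

(** Take [g] equal to 1 at 1, to -1 at [c], and 0 elsewhere. For [a != 1], a nonzero
    [g v * g (a *: v)] involves both points and is negative, so no pair moment is positive; a
    solution equal to 1 at [i0] makes that of [i0], [j0] negative. *)
Lemma uncommon_of_proportional (R : realType) (F : finFieldType) (m k : nat)
    (L : 'M[F]_(m, k)) (i0 j0 : 'I_k) (c : F) :
  irredundant L -> i0 != j0 -> c != 0 -> ~~ zero_var L i0 ->
  proportional L i0 j0 c -> uncommon R L.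
Proof.
move=> irr ij0 c_neq0 nz prop0.
have c_neq1 := irredundant_proportional irr ij0 prop0.
pose g (v : 'rV[F]_1) : R := (v 0 0 == 1)%:R - (v 0 0 == c)%:R.
have g0 : g 0 = 0.
  by rewrite /g mxE ![0 == _]eq_sym oner_eq0 (negPf c_neq0) subrr.
have avg_g : avg [set: 'rV[F]_1] g = 0.
  rewrite /avg (eq_bigl xpredT) => [|v]; last by rewrite inE.
  have point a : \sum_(v : 'rV[F]_1) (v 0 0 == a)%:R = 1 :> R.
    rewrite (bigD1 (const_mx a)) //= mxE eqxx big1 ?addr0 // => v.
    move=> v_neq; case: eqP => // va; case/eqP: v_neq.
    by apply/rowP => t; rewrite !mxE ord1.
  by rewrite sumrB !point subrr mulr0.
have gM_le0 a (v : 'rV[F]_1) : a != 1 -> g v * g (a *: v) <= 0.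
  move=> a_neq1; rewrite /g mxE; set t := v 0 0.
  have [->|_] := eqVneq t 1.
    by rewrite mulr1 eq_sym (negPf c_neq1) (negPf a_neq1) subr0 mul1r sub0r oppr_le0.
  have [->|_] := eqVneq t c; last by rewrite subrr mul0r.
  have /negPf -> : a * c != c.
    by apply: contra a_neq1 => /eqP ac; apply/eqP/(mulIf c_neq0); rewrite mul1r.
  by rewrite subr0 sub0r mulN1r oppr_le0.
have pair_le0 (S : {set 'I_k}) : #|S| == 2%N -> moment L g S <= 0.
  move=> /cards2P[i [j [ij ->]]].
  have [/existsP[a pij]|/existsPn nprop] := boolP [exists a, proportional L i j a].
    have a_neq1 := irredundant_proportional irr ij pij.
    rewrite moment_pair // mulr_ge0_le0 ?invr_ge0 ?ler0n // sumr_le0 // => X solX.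
    by rewrite (proportional_row pij solX) gM_le0.
  have [zi|nzi] := boolP (zero_var L i).
    rewrite moment_pair // mulr_ge0_le0 ?invr_ge0 ?ler0n // sumr_le0 // => X solX.
    by rewrite (zero_var_row zi solX) g0 mul0r.
  by rewrite moment_pair_independent ?avg_g ?expr0n //; apply: pair_independent.
apply: (@uncommon_of_moments R F m k 1 2 L g) => //; first by case=> [|[]].
rewrite (bigD1 [set i0; j0]) /=; last by rewrite cards2 ij0.
rewrite ltr_wnDr //; first by rewrite sumr_le0 // => S /andP[/pair_le0].
have [x Lx x_i] := single_independent nz ord0.
rewrite moment_pair //; apply: (@avg_lt0 _ _ _ _ x) => [X solX||].
- by rewrite (proportional_row prop0 solX) gM_le0.
- by rewrite in_sol Lx.
have solx : x \in sol L [set: 'rV[F]_1] by rewrite in_sol Lx.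
rewrite (proportional_row prop0 solx) /g !mxE.
have -> : x i0 0 = 1 by rewrite (x_i ord0).
rewrite mulr1 !eqxx eq_sym (negPf c_neq1).
by rewrite subr0 mul1r sub0r oppr_lt0 ltr01.
Qed.

(** Take [g] with a large value [G] at 0 but mean -1. Pairs containing the vanishing variable have
    moment [- G], the others are independent and have moment 1, and there are fewer than [G]
    pairs. *)
Lemma uncommon_of_zero_var (R : realType) (F : finFieldType) (m k : nat)
    (L : 'M[F]_(m, k)) (i0 : 'I_k) :
  irredundant L -> (1 < k)%N -> zero_var L i0 ->
  (forall i j c, i != j -> c != 0 -> ~~ zero_var L i -> ~~ proportional L i j c) ->
  uncommon R L.
Proof.
move=> irr k_gt1 z0 nprop.
have nz j : j != i0 -> ~~ zero_var L j.
  by rewrite eq_sym => ij; apply: irredundant_zero_var z0.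
pose q : R := #|F|%:R; pose G : R := 1 + #|{set 'I_k}|%:R.
have q_gt1 : 1 < q by rewrite ltr1n card_finRing_gt1.
(* The value off 0 makes the sum over all [q] points equal to [G - (q + G) = - q]. *)
pose g (v : 'rV[F]_1) : R := if v == 0 then G else - (q + G) / (q - 1).
have avg_g : avg [set: 'rV[F]_1] g = - 1.
  rewrite /avg (eq_bigl xpredT) => [|v]; last by rewrite inE.
  rewrite (bigD1 0) //= (eq_bigr (fun=> - (q + G) / (q - 1))); last first.
    by move=> v /negPf v_neq0; rewrite /g v_neq0.
  have card_rV : #|[set: 'rV[F]_1]| = #|F| by rewrite cardsT card_mx expn1.
  have -> : \sum_(v : 'rV[F]_1 | v != 0) (- (q + G) / (q - 1)) = - (q + G).
    rewrite sumr_const -[_ *+ _]mulr_natl.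
    have -> : #|[pred v : 'rV[F]_1 | v != 0]|%:R = q - 1.
      rewrite /q -card_rV cardsT [in RHS](cardD1 (0 : 'rV[F]_1)) /= natrD addrAC subrr add0r.
      by congr (_%:R); apply: eq_card => v; rewrite !inE andbT.
    by rewrite mulrC divfK // subr_eq0 gt_eqF.
  rewrite card_rV /g eqxx -/q opprD addrCA subrr addr0 mulrN mulVf //.
  by rewrite gt_eqF // (lt_trans ltr01).
have g0 : g 0 = G by rewrite /g eqxx.
have with_i0 j : j != i0 -> moment L g [set i0; j] = - G.
  move=> ji; rewrite moment_pair 1?eq_sym //.
  have := avg_independent (fun=> g) (single_independent (nz j ji)).
  rewrite big_ord_recl big_ord0 mulr1 avg_g => avg_j.
  rewrite -[RHS]mulrN1 -avg_j /avg mulrCA; congr (_ * _).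
  rewrite mulr_sumr; apply: eq_bigr => X solX.
  by rewrite (zero_var_row z0 solX) g0 big_ord_recl big_ord0 mulr1.
have moment_le1 (S : {set 'I_k}) : #|S| == 2%N -> moment L g S <= 1.
  have G_ge0 : 0 <= G by rewrite addr_ge0.
  move=> /cards2P[i [j [ij ->]]].
  have [ii|ii0] := eqVneq i i0.
    by rewrite ii with_i0 -?ii 1?eq_sym //; lra.
  have [jj|jj0] := eqVneq j i0.
    by rewrite setUC jj with_i0 //; lra.
  have ind : independent L (pair_index i j).
    apply: pair_independent (nz i ii0) _ => c.
    have [->|c_neq0] := eqVneq c 0; last by apply: nprop => //; apply: nz.
    by apply: contra (@proportional0 _ _ _ _ _ _) (nz j jj0).
  by rewrite moment_pair_independent // avg_g sqrrN expr1n.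
apply: (@uncommon_of_moments R F m k 1 2 L g) => //; first by case=> [|[]].
have [j ji] : exists j : 'I_k, j != i0.
  have : (0 < #|[set~ i0]|)%N by rewrite cardsC1 card_ord; lia.
  by move=> /card_gt0P[j]; rewrite !inE; exists j.
rewrite (bigD1 [set i0; j]) /=; last by rewrite cards2 (eq_sym i0) ji.
rewrite with_i0 // addrC subr_lt0.
apply: (@le_lt_trans _ _ (\sum_(S : {set 'I_k}) 1)).
  rewrite [leRHS](bigID (fun S : {set 'I_k} => (#|S| == 2%N) && (S != [set i0; j]))) /=.
  rewrite -[leLHS]addr0 lerD ?sumr_ge0 //.
  by apply: ler_sum => S /andP[/moment_le1].
by rewrite sumr_const /G ltrDr.
Qed.

(** * Determined and independent triples *)

Definition determined (F : finFieldType) (m k : nat) (L : 'M[F]_(m, k)) (i j l : 'I_k) :=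
  [forall x : 'cV[F]_k,
    [&& L *m x == 0, x i 0 == 0 & x j 0 == 0] ==> (x l 0 == 0)].

Lemma pairP (F : finFieldType) (m k : nat) (L : 'M[F]_(m, k)) (i j : 'I_k) :
  independent L (pair_index i j) ->
  exists a b : 'cV[F]_k, [/\ L *m a = 0 & L *m b = 0] /\
    [/\ a i 0 = 1, a j 0 = 0, b i 0 = 0 & b j 0 = 1].
Proof.
move=> ind; have [a La a_s] := ind ord0; have [b Lb b_s] := ind ord_max.
exists a, b; split=> //.
by split; [have := a_s ord0|have := a_s ord_max|have := b_s ord0|have := b_s ord_max].
Qed.

(** The coefficients are the values at [l] of the dual vectors of [i] and [j]. If one were 0,
    variable [l] would be a multiple of a single other variable, against pairwise independence. *)
Lemma determined_combination (F : finFieldType) (m k : nat) (L : 'M[F]_(m, k))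
    (i j l : 'I_k) :
  (forall i j, i != j -> independent L (pair_index i j)) ->
  i != j -> i != l -> j != l -> determined L i j l ->
  exists a b, [/\ a != 0, b != 0 &
    forall n (X : 'M[F]_(k, n)), X \in sol L [set: 'rV[F]_n] ->
      row l X = a *: row i X + b *: row j X].
Proof.
move=> ind ij il jl /forallP det.
have [a [b [[La Lb] [ai aj bi bj]]]] := pairP (ind i j ij).
have comb (x : 'cV[F]_k) : L *m x = 0 -> x l 0 = a l 0 * x i 0 + b l 0 * x j 0.
  move=> Lx; have := det (x - x i 0 *: a - x j 0 *: b).
  rewrite !mulmxBr -!scalemxAr Lx La Lb !scaler0 !subr0 !mxE.
  rewrite ai aj bi bj !mulr0 !mulr1 !subr0 !subrr !eqxx /=.
  by rewrite -addrA -opprD subr_eq0 [a l 0 * _]mulrC [b l 0 * _]mulrC => /eqP.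
exists (a l 0), (b l 0); split.
- have lj : l != j by rewrite eq_sym.
  have [c [d [[Lc _] [cl cj _ _]]]] := pairP (ind l j lj).
  apply/eqP => al0; have := comb c Lc.
  by rewrite cj al0 cl mul0r mulr0 addr0; apply/eqP; rewrite oner_eq0.
- have li : l != i by rewrite eq_sym.
  have [c [d [[Lc _] [cl cj _ _]]]] := pairP (ind l i li).
  apply/eqP => bl0; have := comb c Lc.
  by rewrite cj bl0 cl mul0r mulr0 addr0; apply/eqP; rewrite oner_eq0.
move=> n X solX; apply/rowP => t.
by have := comb (col t X) (sol_col t solX); rewrite !mxE.
Qed.

(** A solution vanishing at [i] and [j] but not at [l] is, after scaling, the third dual vector, and
    it corrects entry [l] of the other two. *)
Lemma triple_independent (F : finFieldType) (m k : nat) (L : 'M[F]_(m, k))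
    (i j l : 'I_k) :
  independent L (pair_index i j) -> ~~ determined L i j l -> independent L (triple_index i j l).
Proof.
move=> ind; rewrite negb_forall => /existsP[x]; rewrite negb_imply.
move=> /andP[/and3P[/eqP Lx /eqP xi /eqP xj] xl].
have [a [b [[La Lb] [ai aj bi bj]]]] := pairP ind.
pose c := (x l 0)^-1 *: x.
have [Lc ci cj cl] : [/\ L *m c = 0, c i 0 = 0, c j 0 = 0 & c l 0 = 1].
  by rewrite -scalemxAr Lx scaler0 !mxE xi xj !mulr0 mulVf.
move: c Lc ci cj cl => c Lc ci cj cl.
case=> [[|[|[|//]]] ?].
- exists (a - a l 0 *: c); first by rewrite mulmxBr -scalemxAr La Lc scaler0 subr0.
  case=> [[|[|[|//]]] ?]; rewrite /triple_index /= !mxE.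
  + by rewrite ai ci mulr0 subr0.
  + by rewrite aj cj mulr0 subr0.
  + by rewrite cl mulr1 subrr.
- exists (b - b l 0 *: c); first by rewrite mulmxBr -scalemxAr Lb Lc scaler0 subr0.
  case=> [[|[|[|//]]] ?]; rewrite /triple_index /= !mxE.
  + by rewrite bi ci mulr0 subr0.
  + by rewrite bj cj mulr0 subr0.
  + by rewrite cl mulr1 subrr.
- by exists c => //; case=> [[|[|[|//]]] ?]; rewrite /triple_index /=.
Qed.

(* The kernel of a (2 x 4)-system has dimension 2, so it is spanned by the
   restrictions of two solutions of [L] that are dual to a pair of variables. *)
Lemma subsystem_determined (F : finFieldType) (m k : nat) (L : 'M[F]_(m, k))
    (L' : 'M[F]_(2, 4)) (s : 'I_4 -> 'I_k) (p p' r : 'I_4) :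
  is_system L' ->
  (forall x : 'cV[F]_k, L *m x = 0 -> L' *m (\col_j x (s j) 0) = 0) ->
  independent L (pair_index (s p) (s p')) -> determined L (s p) (s p') (s r).
Proof.
move=> freeL' LL' /pairP[a [b [[La Lb] [ai aj bi bj]]]].
pose M : 'M[F]_(1 + 1, 4) := col_mx (\row_t a (s t) 0) (\row_t b (s t) 0).
have tr_ker (x : 'cV[F]_k) : L *m x = 0 -> (\row_t x (s t) 0) *m L'^T = 0.
  move=> /LL' /(congr1 trmx); rewrite trmx_mul trmx0 => <-; congr (_ *m _).
  by apply/rowP => t; rewrite !mxE.
have M_ker : (M <= kermx L'^T)%MS.
  by apply/sub_kermxP; rewrite mul_col_mx !tr_ker ?col_mx0.
have comb (z : 'rV[F]_(1 + 1)) t : (z *m M) 0 t =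
    z 0 (lshift 1 0) * a (s t) 0 + z 0 (rshift 1 0) * b (s t) 0.
  by rewrite !mxE big_split_ord /= !big_ord1 col_mxEu col_mxEd !mxE.
have M_free : row_free M.
  apply: inj_row_free => z zM0.
  have := comb z p; rewrite zM0 mxE ai bi mulr1 mulr0 addr0 => z0.
  have := comb z p'; rewrite zM0 mxE aj bj mulr1 mulr0 add0r => z1.
  apply/rowP => q; rewrite mxE.
  by case: (splitP q) => q' qE; rewrite ord1 in qE;
    [rewrite z0|rewrite z1]; congr (z 0 _); apply: val_inj.
apply/forallP => x; apply/implyP => /and3P[/eqP Lx /eqP xi /eqP xj].
have ker_M : (kermx L'^T <= M)%MS.
  have [_ <-] := mxrank_leqif_sup M_ker.
  rewrite mxrank_ker mxrank_tr; move: freeL' M_free.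
  by rewrite /is_system /row_free => /eqP -> /eqP ->.
have /submxP[z xz] : (\row_t x (s t) 0 <= M)%MS.
  by apply: submx_trans ker_M; apply/sub_kermxP/tr_ker.
have xE t : x (s t) 0 = z 0 (lshift 1 0) * a (s t) 0 + z 0 (rshift 1 0) * b (s t) 0.
  by have /rowP/(_ t) := xz; rewrite comb mxE.
have := xE p; rewrite xi ai bi mulr1 mulr0 addr0 => z0.
have := xE p'; rewrite xj aj bj mulr1 mulr0 add0r => z1.
by rewrite xE -z0 -z1 !mul0r addr0.
Qed.

(** * Clusters *)

(* A vector of length [3 * N] is read as three blocks of length [N]; [point C h]
   is [C s] times the [h s]-th unit vector in block [s]. Only the first [r]
   positions of each block are used. *)
Definition point (F : finFieldType) (r N : nat) (C : 'I_3 -> F)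
    (h : {ffun 'I_3 -> 'I_r}) : 'rV[F]_(3 * N) :=
  mxvec (\matrix_(s, t) (C s *+ (t == h s :> nat))).

Definition cluster (F : finFieldType) (r N : nat) (C : 'I_3 -> F) : {set 'rV[F]_(3 * N)} :=
  [set point N C h | h : {ffun 'I_3 -> 'I_r}].

(** A linear functional that is constantly [C s] on a cluster when [r <= N], so linear relations
    between points descend to their coefficient vectors. *)
Definition block_sum (F : finFieldType) (N : nat) (v : 'rV[F]_(3 * N)) (s : 'I_3) : F :=
  \sum_t vec_mx v s t.

Lemma pointE (F : finFieldType) (r N : nat) (C : 'I_3 -> F) (h : {ffun 'I_3 -> 'I_r}) s t :
  vec_mx (point N C h) s t = C s *+ (t == h s :> nat).
Proof. by rewrite mxvecK mxE. Qed.

Lemma vec_mx_comb (F : finFieldType) (m n : nat) (x y : 'rV[F]_(m * n)) (a b : F) s t :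
  vec_mx (a *: x + b *: y) s t = a * vec_mx x s t + b * vec_mx y s t.
Proof. by rewrite linearD !linearZ /= !mxE. Qed.

Lemma point_comb (F : finFieldType) (r N : nat) (C D E : 'I_3 -> F) (a b : F)
    (h : {ffun 'I_3 -> 'I_r}) :
  (forall s, E s = a * C s + b * D s) ->
  a *: point N C h + b *: point N D h = point N E h.
Proof.
move=> EE; apply: (can_inj (@vec_mxK _ _ _)); apply/matrixP => s t.
by rewrite vec_mx_comb !pointE EE mulrnDl !mulrnAr.
Qed.

Lemma block_sum_comb (F : finFieldType) (N : nat) (x y : 'rV[F]_(3 * N)) (a b : F) s :
  block_sum (a *: x + b *: y) s = a * block_sum x s + b * block_sum y s.
Proof.
rewrite /block_sum !mulr_sumr -big_split /=; apply: eq_bigr => t _.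
exact: vec_mx_comb.
Qed.

Lemma block_sum_point (F : finFieldType) (r N : nat) (C : 'I_3 -> F)
    (h : {ffun 'I_3 -> 'I_r}) s :
  (r <= N)%N -> block_sum (point N C h) s = C s.
Proof.
move=> rN; rewrite /block_sum (bigD1 (widen_ord rN (h s))) //= pointE eqxx mulr1n.
rewrite big1 ?addr0 // => t /negPf t_neq; rewrite pointE -[_ == _ :> nat]/(t == widen_ord rN (h s)).
by rewrite t_neq mulr0n.
Qed.

Lemma block_sum_cluster (F : finFieldType) (r N : nat) (C : 'I_3 -> F)
    (x : 'rV[F]_(3 * N)) s :
  (r <= N)%N -> x \in cluster r N C -> block_sum x s = C s.
Proof. by move=> rN /imsetP[h _ ->]; apply: block_sum_point. Qed.

(* In each coordinate the points of a cluster take at most two values. *)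
Lemma cluster_line (F : finFieldType) (r N : nat) (C : 'I_3 -> F)
    (x y : 'rV[F]_(3 * N)) (a b : F) :
  a != 0 -> b != 0 -> a + b = 1 -> x \in cluster r N C -> y \in cluster r N C ->
  a *: x + b *: y \in cluster r N C -> x = y.
Proof.
move=> a_neq0 b_neq0 ab /imsetP[h _ ->] /imsetP[h' _ ->] /imsetP[h'' _ e].
apply: (can_inj (@vec_mxK _ _ _)); apply/matrixP => s t.
have := congr1 (fun v => vec_mx v s t) e.
rewrite vec_mx_comb !pointE.
have [->|C_neq0] := eqVneq (C s) 0; first by rewrite !mul0rn.
case: eqP => _; case: eqP => _ //; case: eqP => _; rewrite ?mulr1n ?mulr0n ?mulr0 ?addr0 ?add0r.
- move=> e1; case/eqP: b_neq0; apply: (addrI a); rewrite ab addr0.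
  by apply: (mulIf C_neq0); rewrite mul1r e1.
- by move/eqP; rewrite mulf_eq0 (negPf a_neq0) (negPf C_neq0).
- move=> e1; case/eqP: a_neq0; apply: (addIr b); rewrite ab add0r.
  by apply: (mulIf C_neq0); rewrite mul1r e1.
- by move/eqP; rewrite mulf_eq0 (negPf b_neq0) (negPf C_neq0).
Qed.

Lemma eq_point (F : finFieldType) (r N : nat) (C : 'I_3 -> F) (h h' : {ffun 'I_3 -> 'I_r}) s :
  (r <= N)%N -> C s != 0 -> point N C h = point N C h' -> h s = h' s.
Proof.
move=> rN C_neq0 e.
have := congr1 (fun v => vec_mx v s (widen_ord rN (h s))) e.
rewrite !pointE /= eqxx mulr1n; case: eqP => [hs _|_ /eqP]; first exact: val_inj.
by rewrite mulr0n (negPf C_neq0).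
Qed.

Lemma card_cluster_le (F : finFieldType) (r N : nat) (C : 'I_3 -> F) :
  (#|cluster r N C| <= r ^ 3)%N.
Proof. by apply: leq_trans (leq_imset_card _ _) _; rewrite card_ffun !card_ord. Qed.

Lemma card_cluster (F : finFieldType) (r N : nat) (C : 'I_3 -> F) :
  (r <= N)%N -> (forall s, C s != 0) -> #|cluster r N C| = (r ^ 3)%N.
Proof.
move=> rN C_neq0; rewrite card_imset ?card_ffun ?card_ord // => h h' e.
by apply/ffunP => s; apply: (eq_point rN (C_neq0 s) e).
Qed.

Lemma card_degenerate_cluster_le (F : finFieldType) (r N : nat) (C : 'I_3 -> F) (s : 'I_3) :
  C s = 0 -> (#|cluster r N C| <= r ^ 2)%N.
Proof.
move=> Cs0.
(* As [C s = 0], block [s] is empty, and the value given to index [s] is an arbitrary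
   placeholder. *)
pose lift_h (g : {ffun 'I_2 -> 'I_r}) : {ffun 'I_3 -> 'I_r} :=
  [ffun s' => if unlift s s' is Some t then g t else g ord0].
have sub : cluster r N C \subset [set point N C (lift_h g) | g : {ffun 'I_2 -> 'I_r}].
  apply/subsetP => x /imsetP[h _ ->].
  apply/imsetP; exists [ffun t => h (lift s t)] => //; congr mxvec.
  apply/matrixP => s' t; rewrite !mxE ffunE.
  by case: unliftP => [t' ->|->]; rewrite ?ffunE // Cs0 !mul0rn.
apply: leq_trans (subset_leq_card sub) _; apply: leq_trans (leq_imset_card _ _) _.
by rewrite card_ffun !card_ord.
Qed.

(** * Weighted clusters in general position *)

(** The last condition puts the first four coefficient vectors in a common plane and the fifth
    outside it, so linear relations never lead from the former to the latter. *)
Definition general_position (F : finFieldType) (C : 'I_5 -> 'I_3 -> F) : Prop :=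
  [/\ forall t t' a, (forall s, C t' s = a * C t s) -> t' = t,
      forall t, exists s, C t s != 0 &
      forall t, (\sum_s C t s == 0) = (t != ord_max)].

Definition weighted (R : realType) (F : finFieldType) (r N : nat) (w : 'I_5 -> R)
    (C : 'I_5 -> 'I_3 -> F) (v : 'rV[F]_(3 * N)) : R :=
  \sum_t w t * (v \in cluster r N (C t))%:R.

Lemma cluster_inj (F : finFieldType) (r N : nat) (C : 'I_5 -> 'I_3 -> F) t t' v :
  general_position C -> (r <= N)%N ->
  v \in cluster r N (C t) -> v \in cluster r N (C t') -> t' = t.
Proof.
move=> [noncol _ _] rN vt vt'; apply: (noncol _ _ 1) => s.
by rewrite mul1r -(block_sum_cluster s rN vt) (block_sum_cluster s rN vt').
Qed.

Lemma weighted_in (R : realType) (F : finFieldType) (r N : nat) (w : 'I_5 -> R)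
    (C : 'I_5 -> 'I_3 -> F) t v :
  general_position C -> (r <= N)%N ->
  v \in cluster r N (C t) -> weighted r w C v = w t.
Proof.
move=> gen rN vt; rewrite /weighted (bigD1 t) //= vt mulr1 big1 ?addr0 // => t' t'_neq.
case: (boolP (v \in cluster r N (C t'))) => [vt'|_]; last by rewrite mulr0.
by rewrite (cluster_inj gen rN vt vt') eqxx in t'_neq.
Qed.

Lemma weighted_out (R : realType) (F : finFieldType) (r N : nat) (w : 'I_5 -> R)
    (C : 'I_5 -> 'I_3 -> F) v :
  v \notin \bigcup_t cluster r N (C t) -> weighted r w C v = 0.
Proof.
move=> nv; rewrite /weighted big1 // => t _.
case: (boolP (v \in cluster r N (C t))) => [vt|_]; last by rewrite mulr0.
by case/bigcupP: nv; exists t.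
Qed.

(** Block sums show that [C t'] is [a + b] times [C t], so [t' = t] and [a + b = 1] by general
    position; then [cluster_line] applies. *)
Lemma same_cluster (F : finFieldType) (r N : nat) (C : 'I_5 -> 'I_3 -> F) t t' x y z a b :
  general_position C -> (r <= N)%N -> a != 0 -> b != 0 -> z = a *: x + b *: y ->
  x \in cluster r N (C t) -> y \in cluster r N (C t) -> z \in cluster r N (C t') ->
  x = y /\ z = x.
Proof.
move=> gen rN a_neq0 b_neq0 zE xt yt zt'; have [noncol nz _] := gen.
have CE s : C t' s = (a + b) * C t s.
  rewrite -(block_sum_cluster s rN zt') zE block_sum_comb.
  by rewrite (block_sum_cluster s rN xt) (block_sum_cluster s rN yt) mulrDl.
have tt' := noncol _ _ _ CE; rewrite tt' in zt' CE.
have [s Cs] := nz t.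
have ab : a + b = 1 by apply: (mulIf Cs); rewrite -CE mul1r.
have xy : x = y by apply: (cluster_line a_neq0 b_neq0 ab xt yt); rewrite -zE.
by rewrite zE -xy -scalerDl ab scale1r.
Qed.

Lemma last_cluster (F : finFieldType) (r N : nat) (C : 'I_5 -> 'I_3 -> F) t t' t'' x y a b :
  general_position C -> (r <= N)%N -> t != ord_max -> t' != ord_max ->
  x \in cluster r N (C t) -> y \in cluster r N (C t') ->
  a *: x + b *: y \in cluster r N (C t'') -> t'' != ord_max.
Proof.
move=> [_ _ plane] rN; rewrite -!plane => /eqP t0 /eqP t'0 xt yt' zt''.
rewrite (eq_bigr (fun s => a * C t s + b * C t' s)).
  by rewrite big_split /= -!mulr_sumr t0 t'0 !mulr0 addr0.
move=> s _; rewrite -(block_sum_cluster s rN zt'') block_sum_comb.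
by rewrite (block_sum_cluster s rN xt) (block_sum_cluster s rN yt').
Qed.

Lemma set4_third (T : finType) (S : {set T}) (p q : T) :
  #|S| = 4%N -> exists2 l, l \in S & (p != l) && (q != l).
Proof.
move=> cS; have : (0 < #|S :\ p :\ q|)%N.
  have := cardsD1 p S; have := cardsD1 q (S :\ p); rewrite cS.
  by case: (p \in S); case: (q \in S :\ p) => /=; lia.
move=> /card_gt0P[l]; rewrite !inE => /and3P[lq lp lS].
by exists l => //; rewrite eq_sym lp eq_sym lq.
Qed.

(* A solution of a codimension-2 subsystem inside the support is either constant,
   or has one point in each of the first four clusters. *)
Lemma weighted_prod_le (R : realType) (F : finFieldType) (k r N : nat) (w : 'I_5 -> R)
    (C : 'I_5 -> 'I_3 -> F) (y : 'I_k -> 'rV[F]_(3 * N)) (S : {set 'I_k}) (i j : 'I_k) :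
  general_position C -> (r <= N)%N -> \prod_(t | t != ord_max) w t <= 0 ->
  #|S| = 4%N -> i \in S -> j \in S ->
  (forall p q l, p \in S -> q \in S -> l \in S -> p != q -> p != l -> q != l ->
     exists a b, [/\ a != 0, b != 0 & y l = a *: y p + b *: y q]) ->
  \prod_(l in S) weighted r w C (y l) <=
    (y i == y j)%:R * weighted r w C (y i) ^+ 4.
Proof.
move=> gen rN w_le0 cS iS jS lin.
have rhs_ge0 : 0 <= (y i == y j)%:R * weighted r w C (y i) ^+ 4.
  by rewrite mulr_ge0 // exprn_even_ge0.
have [/exists_inP[l lS ly]|] :=
    boolP [exists l in S, y l \notin \bigcup_t cluster r N (C t)].
  by rewrite (bigD1 l) //= weighted_out // mul0r.
rewrite negb_exists_in => /forall_inP supp.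
have suppP l : l \in S -> exists t, y l \in cluster r N (C t).
  by move=> /supp; rewrite negbK => /bigcupP[t]; exists t.
pose tau l : 'I_5 := odflt ord0 [pick t | y l \in cluster r N (C t)].
have tauP l : l \in S -> y l \in cluster r N (C (tau l)).
  move=> /suppP[t yt]; rewrite /tau; case: pickP => //= nt.
  by have := nt t; rewrite yt.
(* Two variables in one cluster force all four points to coincide. *)
have [/exists_inP[p pS /exists_inP[q qS /andP[pq /eqP tau_pq]]]|] :=
    boolP [exists p in S, [exists q in S, (p != q) && (tau p == tau q)]].
  have yq := tauP q qS; rewrite -tau_pq in yq.
  have const l : l \in S -> p != l -> q != l -> y p = y q /\ y l = y p.
    move=> lS pl ql; have [a [b [a_neq0 b_neq0 yl]]] := lin p q l pS qS lS pq pl ql.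
    exact: same_cluster gen rN a_neq0 b_neq0 yl (tauP p pS) yq (tauP l lS).
  have [l0 l0S /andP[pl0 ql0]] := set4_third p q cS.
  have [ypq _] := const l0 l0S pl0 ql0.
  have all_p l : l \in S -> y l = y p.
    move=> lS; have [<-//|pl] := eqVneq p l.
    by have [<-//|ql] := eqVneq q l; have [] := const l lS pl ql.
  rewrite (eq_bigr (fun=> weighted r w C (y p))) => [|l /all_p -> //].
  by rewrite prodr_const cS !all_p // eqxx mul1r.
rewrite negb_exists_in => /forall_inP tau_inj.
have inj : {in S &, injective tau}.
  move=> p q pS qS tau_pq; apply/eqP; apply: contraT => pq.
  have := tau_inj p pS; rewrite negb_exists_in => /forall_inP/(_ q qS).
  by rewrite pq tau_pq eqxx.
(* A point in the fifth cluster would be a combination of two points from the first four. *)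
have not_last l : l \in S -> tau l != ord_max.
  move=> lS; apply/negP => /eqP tl.
  have [p pS /andP[lp _]] := set4_third l l cS.
  have [q qS /andP[lq pq]] := set4_third l p cS.
  have ne x : x \in S -> l != x -> tau x != ord_max.
    move=> xS; apply: contraNneq => tx; apply/eqP; apply: inj => //.
    by rewrite tl tx.
  have pl : p != l by rewrite eq_sym.
  have ql : q != l by rewrite eq_sym.
  have [a [b [_ _ yl]]] := lin p q l pS qS lS pq pl ql.
  have zl := tauP l lS; rewrite yl in zl.
  have := last_cluster gen rN (ne p pS lp) (ne q qS lq) (tauP p pS) (tauP q qS) zl.
  by rewrite tl eqxx.
apply: le_trans rhs_ge0.
rewrite (eq_bigr (fun l => w (tau l))) => [|l lS]; last first.
  by rewrite (weighted_in w gen rN (tauP l lS)).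
rewrite -(big_imset _ inj) /=.
(* Four distinct labels other than [ord_max] exhaust the first four clusters, so the product is that
   of their weights. *)
have -> : [set tau l | l in S] = [set~ ord_max].
  apply/eqP; rewrite eqEcard cardsC1 card_ord card_in_imset // cS leqnn andbT.
  by apply/subsetP => t /imsetP[l lS ->]; rewrite !inE not_last.
by rewrite (eq_bigl (fun t => t != ord_max)) // => t; rewrite !inE.
Qed.

(** * Bounds on the moments of the weighted function *)

Lemma avg_sum (R : realType) (T I : finType) (P : {set T}) (G : I -> T -> R) :
  avg P (fun x => \sum_i G i x) = \sum_i avg P (G i).
Proof. by rewrite /avg exchange_big mulr_sumr. Qed.

Lemma avgD (R : realType) (T : finType) (P : {set T}) (G H : T -> R) :
  avg P (fun x => G x + H x) = avg P G + avg P H.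
Proof. by rewrite /avg big_split mulrDr. Qed.

Lemma avgZ (R : realType) (T : finType) (P : {set T}) (c : R) (G : T -> R) :
  avg P (fun x => c * G x) = c * avg P G.
Proof. by rewrite /avg mulrCA -mulr_sumr. Qed.

Lemma avg_mem (R : realType) (T : finType) (A : {set T}) :
  avg [set: T] (fun v => (v \in A)%:R) = #|A|%:R / #|T|%:R :> R.
Proof.
rewrite /avg cardsT mulrC; congr (_ / _).
rewrite (eq_bigl xpredT) => [|v]; last by rewrite inE.
by rewrite -sum1_card natr_sum [RHS]big_mkcond; apply: eq_bigr => v _; case: ifP.
Qed.

Lemma avg_two_points (R : realType) (F : finFieldType) (m k n : nat)
    (L : 'M[F]_(m, k)) (i j : 'I_k) (u v : 'rV[F]_n) :
  independent L (pair_index i j) ->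
  avg (sol L [set: 'rV[F]_n])
    (fun X => (row i X == u)%:R * (row j X == v)%:R) = #|{: 'rV[F]_n}|%:R ^- 2 :> R.
Proof.
move=> ind.
have point w : avg [set: 'rV[F]_n] (fun x => (x == w)%:R) = #|{: 'rV[F]_n}|%:R^-1 :> R.
  have := avg_mem R [set w]; rewrite cards1 mul1r => <-.
  by congr (_ * _); apply: eq_bigr => x _; rewrite inE.
have := avg_pair (fun x => (x == u)%:R : R) (fun x => (x == v)%:R) ind.
by rewrite !point => ->; rewrite -expr2 exprVn.
Qed.

Lemma avg_diagonal (R : realType) (F : finFieldType) (m k n : nat)
    (L : 'M[F]_(m, k)) (i j : 'I_k) (g : 'rV[F]_n -> R) :
  independent L (pair_index i j) ->
  avg (sol L [set: 'rV[F]_n])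
    (fun X => (row i X == row j X)%:R * g (row i X)) =
  #|{: 'rV[F]_n}|%:R ^- 2 * \sum_v g v.
Proof.
move=> ind; rewrite mulr_sumr.
transitivity (avg (sol L [set: 'rV[F]_n])
    (fun X => \sum_v g v * ((row i X == v)%:R * (row j X == v)%:R))).
  congr (_ * _); apply: eq_bigr => X _.
  rewrite (bigD1 (row i X)) //= eqxx mul1r mulrC [row j X == _]eq_sym big1 ?addr0 //.
  by move=> v /negPf v_neq; rewrite eq_sym v_neq mul0r mulr0.
rewrite avg_sum; apply: eq_bigr => v _.
by rewrite avgZ avg_two_points // mulrC.
Qed.

(** Clusters are disjoint, so powers apply to each weight separately; the exponent is positive, so
    points off the support contribute 0. *)
Lemma sum_weighted (R : realType) (F : finFieldType) (r N e : nat) (w : 'I_5 -> R)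
    (C : 'I_5 -> 'I_3 -> F) :
  general_position C -> (r <= N)%N ->
  \sum_v weighted (N := N) r w C v ^+ e.+1 = \sum_t w t ^+ e.+1 * #|cluster r N (C t)|%:R.
Proof.
move=> gen rN.
have weightedX v :
    weighted r w C v ^+ e.+1 = \sum_t w t ^+ e.+1 * (v \in cluster r N (C t))%:R.
  have [/bigcupP[t _ vt]|nv] := boolP (v \in \bigcup_t cluster r N (C t)).
    rewrite (weighted_in w gen rN vt) (bigD1 t) //= vt mulr1 big1 ?addr0 // => t' t'_neq.
    case: (boolP (v \in cluster r N (C t'))) => [vt'|_]; last by rewrite mulr0.
    by rewrite (cluster_inj gen rN vt vt') eqxx in t'_neq.
  rewrite weighted_out // expr0n big1 // => t _.
  case: (boolP (v \in cluster r N (C t))) => [vt|_]; last by rewrite mulr0.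
  by case/bigcupP: nv; exists t.
under eq_bigr do rewrite weightedX.
rewrite exchange_big; apply: eq_bigr => t _; rewrite -mulr_sumr; congr (_ * _).
by rewrite -sum1_card natr_sum [RHS]big_mkcond; apply: eq_bigr => v _; case: ifP.
Qed.

Lemma moment_determined_le (R : realType) (F : finFieldType) (m k r N : nat)
    (L : 'M[F]_(m, k)) (w : 'I_5 -> R) (C : 'I_5 -> 'I_3 -> F) (S : {set 'I_k}) :
  (forall i j, i != j -> independent L (pair_index i j)) ->
  general_position C -> (r <= N)%N -> \prod_(t | t != ord_max) w t <= 0 ->
  #|S| = 4%N ->
  (forall i j l, i \in S -> j \in S -> l \in S -> i != j -> i != l -> j != l ->
     determined L i j l) ->
  moment L (weighted (N := N) r w C) S <=
    #|{: 'rV[F]_(3 * N)}|%:R ^- 2 * \sum_v weighted (N := N) r w C v ^+ 4.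
Proof.
move=> ind gen rN w_le0 cS det.
have [i iS] : exists i, i \in S by apply/card_gt0P; rewrite cS.
have [j jS /andP[ij _]] := set4_third i i cS.
rewrite -(avg_diagonal (fun v => weighted r w C v ^+ 4) (ind i j ij)).
apply: avg_le => X solX; apply: weighted_prod_le => // p q l pS qS lS pq pl ql.
have [a [b [a_neq0 b_neq0 rowE]]] :=
  determined_combination ind pq pl ql (det p q l pS qS lS pq pl ql).
by exists a, b; split=> //; apply: rowE.
Qed.

(** If rows [i] and [j] are the points with index [h] of the first two clusters, then every row
    [s t] is the point with index [h] of its own cluster, and the product is exactly that of the
    weights. This gives a term for each of the [r ^ 3] indices [h]; other solutions obey
    [weighted_prod_le]. *)
Lemma moment_transversal_le (R : realType) (F : finFieldType) (m k r N : nat)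
    (L : 'M[F]_(m, k)) (w : 'I_5 -> R) (C : 'I_5 -> 'I_3 -> F) (s : 'I_4 -> 'I_k)
    (a b : 'I_4 -> F) :
  let e := widen_ord (leqnSn 4) in
  let i := s (inord 0) in let j := s (inord 1) in
  (forall i j, i != j -> independent L (pair_index i j)) ->
  general_position C -> (r <= N)%N -> \prod_t w (e t) <= 0 -> injective s ->
  (forall i j l, i != j -> i != l -> j != l -> determined L (s i) (s j) (s l)) ->
  (forall s', C (e (inord 0)) s' != 0 \/ C (e (inord 1)) s' != 0) ->
  (forall t s', C (e t) s' = a t * C (e (inord 0)) s' + b t * C (e (inord 1)) s') ->
  (forall t (X : 'M[F]_(k, 3 * N)), X \in sol L [set: 'rV[F]_(3 * N)] ->
     row (s t) X = a t *: row i X + b t *: row j X) ->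
  moment L (weighted (N := N) r w C) [set s t | t : 'I_4] <=
    #|{: 'rV[F]_(3 * N)}|%:R ^- 2 *
      (\sum_v weighted (N := N) r w C v ^+ 4 + (\prod_t w (e t)) * (r ^ 3)%:R).
Proof.
move=> e i j ind gen rN w_le0 s_inj det cover CE rowE.
set f := weighted (N := N) r w C; set W := \prod_t w (e t); set S := [set s t | t : 'I_4].
have w_le0' : \prod_(t | t != ord_max) w t <= 0.
  rewrite big_mkcond big_ord_recr /= mulr1.
  rewrite (eq_bigr (fun t => w (e t))) // => t _.
  by rewrite -val_eqE /= ltn_eqF.
have ij : i != j by rewrite (inj_eq s_inj) -val_eqE /= !inordK.
have ind_ij := ind i j ij.
have cS : #|S| = 4%N by rewrite card_imset // card_ord.
have iS : i \in S by apply: imset_f.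
have jS : j \in S by apply: imset_f.
pose p0 := point N (C (e (inord 0))) : {ffun 'I_3 -> 'I_r} -> _.
pose p1 := point N (C (e (inord 1))) : {ffun 'I_3 -> 'I_r} -> _.
have -> : #|{: 'rV[F]_(3 * N)}|%:R ^- 2 * (\sum_v f v ^+ 4 + W * (r ^ 3)%:R) =
    avg (sol L [set: 'rV[F]_(3 * N)]) (fun X => (row i X == row j X)%:R * f (row i X) ^+ 4 +
      \sum_h W * ((row i X == p0 h)%:R * (row j X == p1 h)%:R)).
  rewrite avgD (avg_diagonal (fun v => f v ^+ 4) ind_ij) mulrDr; congr (_ + _); rewrite avg_sum.
  rewrite (eq_bigr (fun=> W * #|{: 'rV[F]_(3 * N)}|%:R ^- 2)) => [|h _].
    by rewrite sumr_const card_ffun !card_ord -[RHS]mulr_natr mulrCA mulrA.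
  by rewrite avgZ avg_two_points.
apply: avg_le => X solX.
have [/existsP[h /andP[/eqP ih /eqP jh]]|] :=
    boolP [exists h, (row i X == p0 h) && (row j X == p1 h)].
  rewrite (big_imset _ (in2W s_inj)) /=.
  have fE t : f (row (s t) X) = w (e t).
    rewrite rowE // ih jh (@point_comb _ _ _ _ _ (C (e t))) //.
    by apply: (weighted_in w gen rN); apply: imset_f.
  rewrite (eq_bigl xpredT) // (eq_bigr _ (fun t _ => fE t)) -/W.
  rewrite (bigD1 h) //= ih jh !eqxx !mulr1 big1 => [|h' h'_neq].
    by rewrite addr0 lerDr mulr_ge0 // exprn_even_ge0.
  (* An [h'] with the same two points equals [h], since by [cover] each block is visible in one of
     them. *)
  case: eqP => [e0|_]; last by rewrite mul0r mulr0.
  case: eqP => [e1|_]; last by rewrite !mulr0.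
  case/eqP: h'_neq; apply/ffunP => s'.
  by case: (cover s') => nz; apply/esym; [apply: (eq_point rN nz e0)|apply: (eq_point rN nz e1)].
rewrite negb_exists => nh; rewrite [X in _ + X]big1 ?addr0 => [|h _]; last first.
  have := forallP nh h; rewrite negb_and.
  by case/orP => /negPf ->; rewrite ?mul0r ?mulr0 ?mul0r ?mulr0.
apply: weighted_prod_le => // p q l /imsetP[tp _ ->] /imsetP[tq _ ->] /imsetP[tl _ ->] pq pl ql.
have d : determined L (s tp) (s tq) (s tl).
  by apply: det; rewrite -(inj_eq s_inj).
have [a' [b' [a_neq0 b_neq0 rowE']]] := determined_combination ind pq pl ql d.
by exists a', b'; split=> //; apply: rowE'.
Qed.

(** The product is at most 1 and vanishes unless the three independent rows [i], [j], [l] all lie in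
    [A]. *)
Lemma moment_undetermined_le (R : realType) (F : finFieldType) (m k n : nat)
    (L : 'M[F]_(m, k)) (f : 'rV[F]_n -> R) (A : {set 'rV[F]_n}) (S : {set 'I_k}) (i j l : 'I_k) :
  (forall v, `|f v| <= 1) -> (forall v, v \notin A -> f v = 0) ->
  i \in S -> j \in S -> l \in S -> independent L (triple_index i j l) ->
  moment L f S <= (#|A|%:R / #|{: 'rV[F]_n}|%:R) ^+ 3.
Proof.
move=> f_le1 f_supp iS jS lS ind.
rewrite -avg_mem -(avg_triple _ ind); apply: avg_le => X _.
have vanish p : p \in S -> row p X \notin A -> \prod_(q in S) f (row q X) = 0.
  by move=> pS /f_supp fp; rewrite (bigD1 p) //= fp mul0r.
have [iA|/(vanish i iS) ->] := boolP (row i X \in A); last by rewrite !mulr_ge0.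
have [jA|/(vanish j jS) ->] := boolP (row j X \in A); last by rewrite !mulr_ge0.
have [lA|/(vanish l lS) ->] := boolP (row l X \in A); last by rewrite !mulr_ge0.
rewrite !mulr1; apply: le_trans (ler_norm _) _; rewrite normr_prod.
by apply: prodr_ile1 => q _; rewrite normr_ge0 f_le1.
Qed.

(* Rows 2 and 3 are the combinations [a C_0 + b C_1] and [a u C_0 + b v C_1] of
   the first two; row 4 lies outside their span and only serves to make the
   total weight zero. The vanishing pattern of a row together with that of its
   sum tells the five rows apart up to scaling. *)
Definition coef (F : finFieldType) (a b u v : F) (t : 'I_5) (s : 'I_3) : F :=
  nth 0 (nth [::] [:: [:: a^-1; - a^-1; 0]; [:: 0; b^-1; - b^-1]; [:: 1; 0; -1];
                      [:: u; v - u; - v]; [:: 1; 1; -1]] t) s.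

Lemma coef_general_position (F : finFieldType) (a b u v : F) :
  a != 0 -> b != 0 -> u != 0 -> v != 0 -> u != v -> general_position (coef a b u v).
Proof.
move=> a0 b0 u0 v0 uv.
pose C := coef a b u v.
have sumE t : \sum_s C t s = (t == ord_max)%:R.
  rewrite !big_ord_recl big_ord0 /C /coef.
  by case: t => [[|[|[|[|[|//]]]]] ?] /=; rewrite -?val_eqE /= ?mulr1n ?mulr0n; ring.
(* Here [true] marks a zero entry; [u != v] enters through the middle entry of row 3. *)
have nzE t s : (C t s == 0) =
    nth true (nth [::] [:: [:: false; false; true]; [:: true; false; false];
      [:: false; true; false]; [:: false; false; false]; [:: false; false; false]] t) s.
  have vu : (v - u == 0) = false by rewrite subr_eq0 eq_sym (negPf uv).
  rewrite /C /coef; case: t => [[|[|[|[|[|//]]]]] ?]; case: s => [[|[|[|//]]] ?] /=;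
    rewrite ?oppr_eq0 ?invr_eq0 ?oner_eq0 ?eqxx ?vu //; exact: negPf.
have bE (x : bool) : (x%:R == 0 :> F) = ~~ x by case: x; rewrite ?oner_eq0 ?eqxx.
split.
- move=> t t' l CE.
  (* No row vanishes at both of its first two positions, so the scalar is nonzero and preserves the
     vanishing patterns. *)
  have l0 : l != 0.
    apply/eqP => l0; have := sumE t'; have z s : C t' s == 0 by rewrite [C t' s]CE l0 mul0r.
    have := z (inord 0); have := z (inord 1); rewrite !nzE !inordK //.
    by case: t' {CE z} => [[|[|[|[|[|//]]]]] ?].
  have zE s : (C t' s == 0) = (C t s == 0) by rewrite [C t' s]CE mulf_eq0 (negPf l0).
  have sE : (t' == ord_max) = (t == ord_max).
    have : (\sum_s C t' s == 0) = (\sum_s C t s == 0).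
      rewrite (eq_bigr (fun s => l * C t s)) => [|s _]; last exact: CE.
      by rewrite -mulr_sumr mulf_eq0 (negPf l0).
    by rewrite !sumE !bE => /negb_inj.
  have := zE (inord 0); have := zE (inord 1); have := zE (inord 2).
  rewrite !nzE !inordK //; move: sE; rewrite -!val_eqE /=.
  by case: t {CE zE} => [[|[|[|[|[|//]]]]] ?]; case: t' => [[|[|[|[|[|//]]]]] ?] //= *;
    apply: val_inj.
- move=> t; case: (boolP (C t (inord 0) == 0)) => [|nz]; last by exists (inord 0).
  move=> z; exists (inord 2); move: z; rewrite -/(C _ _) !nzE !inordK //.
  by case: t => [[|[|[|[|[|//]]]]] ?].
- by move=> t; rewrite sumE bE.
Qed.

Lemma card_bigcup_le (T I : finType) (A : I -> {set T}) (n : nat) :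
  (forall i, #|A i| <= n)%N -> (#|\bigcup_i A i| <= #|I| * n)%N.
Proof.
move=> A_le; rewrite -sum_nat_const.
elim/big_rec2: _ => [|i B s _ IH]; first by rewrite cards0.
by apply: leq_trans (leq_card_setU _ _) _; rewrite leq_add.
Qed.

(* [K] bounds the number of 4-element sets, [c] is minus the weight of the fourth
   cluster, [M] the order of the ambient group. *)
Lemma leading_term_negative (R : realType) (K c r M : R) :
  1 <= K -> c = 1 / (2 * K) -> r = 24 * K ^+ 2 -> 0 < M ->
  1000 * K ^+ 2 * r ^+ 6 <= M ->
  K * (3 * r ^+ 2 + 2 * (c ^+ 4 * r ^+ 3) + (5 * r ^+ 3) ^+ 3 / M) - c * r ^+ 3 < 0.
Proof.
move=> K_ge1 cE rE M_gt0 M_ge.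
have K_gt0 : 0 < K by lra.
have r_gt0 : 0 < r by rewrite rE mulr_gt0 ?exprn_gt0 ?ltr0n.
(* The gain [c * r ^+ 3] is [4 * x], and each of the three losses is at most [x]. *)
pose x := r ^+ 3 / (8 * K).
have x_gt0 : 0 < x by rewrite divr_gt0 ?mulr_gt0 ?exprn_gt0 ?ltr0n.
have e1 : K * (3 * r ^+ 2) = x.
  have -> : x = r ^+ 2 * (r / (8 * K)) by rewrite /x exprSr mulrA.
  by rewrite [in r / _]rE; field; lra.
have e2 : K * (2 * (c ^+ 4 * r ^+ 3)) <= x.
  have -> : K * (2 * (c ^+ 4 * r ^+ 3)) = x * K ^- 2.
    by rewrite cE /x; field; lra.
  by rewrite ler_piMr ?(ltW x_gt0) // invf_le1 ?exprn_gt0 // exprn_ege1.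
have e3 : K * ((5 * r ^+ 3) ^+ 3 / M) <= x.
  rewrite mulrA ler_pdivrMr // /x mulrAC ler_pdivlMr ?mulr_gt0 ?ltr0n //.
  have := ler_wpM2l (ltW (exprn_gt0 3 r_gt0)) M_ge; apply: le_trans.
  by rewrite le_eqVlt; apply/orP; left; apply/eqP; ring.
have e4 : c * r ^+ 3 = 4 * x by rewrite cE /x; field; lra.
by rewrite e4 !mulrDr e1; lra.
Qed.

(** * The main case *)

(** [u] and [v] are the ratios of the coefficients of the fourth variable to those of the third;
    [u = v] would make these two variables proportional. *)
Lemma subsystem_shape (F : finFieldType) (m k : nat) (L : 'M[F]_(m, k))
    (s : 'I_4 -> 'I_k) :
  (forall i j, i != j -> independent L (pair_index i j)) -> injective s ->
  (forall i j l, i != j -> i != l -> j != l -> determined L (s i) (s j) (s l)) ->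
  exists a b u v : F, [/\ a != 0, b != 0, u != 0, v != 0 & u != v] /\
    forall n t (X : 'M[F]_(k, n)), X \in sol L [set: 'rV[F]_n] ->
      row (s t) X = nth 0 [:: 1; 0; a; a * u] t *: row (s (inord 0)) X +
                    nth 0 [:: 0; 1; b; b * v] t *: row (s (inord 1)) X.
Proof.
move=> ind s_inj det.
have neq (i j : nat) : (i < 4)%N -> (j < 4)%N -> i != j -> (inord i : 'I_4) != inord j.
  by move=> i4 j4 ij; rewrite -val_eqE /= !inordK.
have sneq (i j : nat) : (i < 4)%N -> (j < 4)%N -> i != j -> s (inord i) != s (inord j).
  by move=> i4 j4 ij; rewrite (inj_eq s_inj) neq.
have [a [b [a0 b0 row2]]] := determined_combination ind (sneq 0 1 isT isT isT)%N
  (sneq 0 2 isT isT isT)%N (sneq 1 2 isT isT isT)%N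
  (det _ _ _ (neq 0 1 isT isT isT) (neq 0 2 isT isT isT) (neq 1 2 isT isT isT))%N.
have [c [d [c0 d0 row3]]] := determined_combination ind (sneq 0 1 isT isT isT)%N
  (sneq 0 3 isT isT isT)%N (sneq 1 3 isT isT isT)%N
  (det _ _ _ (neq 0 1 isT isT isT) (neq 0 3 isT isT isT) (neq 1 3 isT isT isT))%N.
exists a, b, (c / a), (d / b); split.
  split; rewrite ?mulf_neq0 ?invr_eq0 //; apply/eqP => cd.
  have [_ [x [[_ Lx] [_ _ x2 x3]]]] := pairP (ind _ _ (sneq 2 3 isT isT isT)%N).
  have solx : x \in sol L [set: 'rV[F]_1] by rewrite in_sol Lx.
  have := congr1 (fun z : 'rV_1 => z 0 0) (row2 _ x solx).
  have := congr1 (fun z : 'rV_1 => z 0 0) (row3 _ x solx).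
  rewrite !mxE x2 x3 => e3 e2.
  have : 1 = c / a * (a * x (s (inord 0)) 0 + b * x (s (inord 1)) 0).
    by rewrite e3 mulrDr mulrA divfK // cd mulrA divfK.
  by rewrite -e2 mulr0; apply/eqP; rewrite oner_eq0.
move=> n t X solX; rewrite ![_ * (_ / _)]mulrC !divfK //.
case: t => [[|[|[|[|//]]]] t4] /=.
- by rewrite scale1r scale0r addr0; congr (row (s _) X); apply: val_inj; rewrite /= inordK.
- by rewrite scale1r scale0r add0r; congr (row (s _) X); apply: val_inj; rewrite /= inordK.
- by rewrite -row2 //; congr (row (s _) X); apply: val_inj; rewrite /= inordK.
- by rewrite -row3 //; congr (row (s _) X); apply: val_inj; rewrite /= inordK.
Qed.

Lemma uncommon_of_independent (R : realType) (F : finFieldType) (m k : nat)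
    (L : 'M[F]_(m, k)) (s : 'I_4 -> 'I_k) :
  (forall i j, i != j -> independent L (pair_index i j)) -> injective s ->
  (forall i j l, i != j -> i != l -> j != l -> determined L (s i) (s j) (s l)) ->
  uncommon R L.
Proof.
move=> ind s_inj det.
have [a [b [u [v [[a0 b0 u0 v0 uv] rowE]]]]] := subsystem_shape ind s_inj det.
pose C := coef a b u v.
have gen : general_position C by apply: coef_general_position.
pose K := #|{set 'I_k}|.
have K_gt0 : (0 < K)%N by apply/card_gt0P; exists set0.
pose r := (24 * K ^ 2)%N.
have r_gt0 : (0 < r)%N by rewrite muln_gt0 expn_gt0 K_gt0.
(* The summand [r] leaves room for [r] positions in each block; the other one makes the space large
   enough, since [#|F| ^ N] exceeds [N]. *)
pose N := (r + 1000 * K ^ 2 * r ^ 6)%N.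
have rN : (r <= N)%N by apply: leq_addr.
pose A t := cluster r N (C t); pose V := {: 'rV[F]_(3 * N)}.
pose c : R := 1 / (2 * K%:R).
have K_ge1 : 1 <= K%:R :> R by rewrite ler1n.
have [c_gt0 c_le1] : 0 < c /\ c <= 1.
  by rewrite /c divr_gt0 ?ler_pdivrMr; lra.
have V_ge : 1000 * K%:R ^+ 2 * r%:R ^+ 6 <= #|V|%:R :> R.
  rewrite -!natrX -!natrM ler_nat; apply: (leq_trans (leq_addl r _)).
  rewrite -/N /V card_mx mul1n; apply: (@leq_trans (#|F| ^ N)).
    by apply: ltnW; apply: ltn_expl; rewrite card_finRing_gt1.
  by rewrite leq_exp2l ?card_finRing_gt1 // leq_pmull.
have V_gt0 : 0 < #|V|%:R :> R by rewrite ltr0n; apply/card_gt0P; exists 0.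
have A4 : #|A ord_max| = (r ^ 3)%N.
  apply: card_cluster => // s'.
  case: s' => [[|[|[|//]]] ?]; rewrite /C /coef /= ?oner_eq0 // oppr_eq0 oner_eq0 //.
(* This solves for total weight zero, the last cluster having exactly [r ^ 3] points. *)
pose w4 : R := (c * #|A (inord 3)|%:R
  - (#|A (inord 0)|%:R + #|A (inord 1)|%:R + #|A (inord 2)|%:R)) / (r ^ 3)%:R.
pose w (t : 'I_5) : R := nth 0 [:: 1; 1; 1; - c; w4] t.
pose f := weighted (N := N) r w C.
have A_small (t : nat) : (t < 3)%N -> #|A (inord t)|%:R <= r%:R ^+ 2 :> R.
  move=> t3; rewrite -natrX ler_nat.
  have inordE : (inord t : 'I_5) = t :> nat by rewrite inordK // (leq_trans t3).
  have [s' Cs'] : exists s', C (inord t) s' = 0.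
    rewrite /C /coef inordE.
    case: t t3 {inordE} => [|[|[|//]]] _; [exists (inord 2)|exists (inord 0)|exists (inord 1)];
    by rewrite inordK.
  exact: card_degenerate_cluster_le Cs'.
have A3 : #|A (inord 3)|%:R <= r%:R ^+ 3 :> R by rewrite -natrX ler_nat card_cluster_le.
have r3_gt0 : 0 < r%:R ^+ 3 :> R by rewrite exprn_gt0 // ltr0n.
(* Here [c * r = 12 * K]; hence the first three clusters cannot push [w4] below [- c]. *)
have r2_le : 3 * r%:R ^+ 2 <= c * r%:R ^+ 3 :> R.
  rewrite [in leRHS]exprSr mulrA [c * _]mulrC -mulrA mulrC ler_wpM2l ?exprn_ge0 //.
  rewrite /c /r natrM natrX mul1r mulrC ler_pdivlMr; nra.
have w4_le : `|w4| <= c.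
  have := A_small 0%N isT; have := A_small 1%N isT; have := A_small 2%N isT.
  rewrite /w4 natrX normrM normfV [X in _ / X]gtr0_norm // ler_pdivrMr // => h2 h1 h0.
  have cA3 : c * #|A (inord 3)|%:R <= c * r%:R ^+ 3 by rewrite ler_pM2l.
  have cA3_ge0 : 0 <= c * #|A (inord 3)|%:R by rewrite mulr_ge0 // ltW.
  rewrite ler_norml; apply/andP; split.
    by lra.
  have : 0 <= #|A (inord 0)|%:R :> R by [].
  have : 0 <= #|A (inord 1)|%:R :> R by [].
  have : 0 <= #|A (inord 2)|%:R :> R by [].
  lra.
have sum5 (G : 'I_5 -> R) : \sum_t G t =
    G (inord 0) + G (inord 1) + G (inord 2) + G (inord 3) + G ord_max.
  rewrite !big_ord_recl big_ord0 addr0 !addrA.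
  by congr (G _ + G _ + G _ + G _ + G _); apply: val_inj; rewrite /= ?inordK.
have sumf : \sum_x f x = 0.
  have := sum_weighted 0 w gen rN; rewrite sum5.
  rewrite (eq_bigr f) => [->|x _]; last by rewrite expr1.
  rewrite !expr1 -!/(A _) A4 /w !inordK //= /w4 divfK; last first.
    by rewrite pnatr_eq0 -lt0n expn_gt0 r_gt0.
  by ring.
have sumf4 : \sum_x f x ^+ 4 <= 3 * r%:R ^+ 2 + 2 * (c ^+ 4 * r%:R ^+ 3).
  rewrite (sum_weighted 3 w gen rN) sum5.
  rewrite -!/(A _) A4 /w !inordK //= !expr1n !mul1r natrX.
  have h0 := A_small 0%N isT; have h1 := A_small 1%N isT; have h2 := A_small 2%N isT.
  have -> : (- c) ^+ 4 = c ^+ 4 by ring.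
  have h3 : c ^+ 4 * #|A (inord 3)|%:R <= c ^+ 4 * r%:R ^+ 3.
    by rewrite ler_wpM2l ?exprn_ge0 // ltW.
  have h4 : w4 ^+ 4 * r%:R ^+ 3 <= c ^+ 4 * r%:R ^+ 3.
    rewrite ler_wpM2r ?(ltW r3_gt0) //.
    have -> : w4 ^+ 4 = `|w4| ^+ 4 by rewrite -normrX ger0_norm // exprn_even_ge0.
    by rewrite lerXn2r ?nnegrE ?normr_ge0 ?(ltW c_gt0).
  by lra.
have f_le1 x : `|f x| <= 1.
  have [/bigcupP[t _ xt]|nx] := boolP (x \in \bigcup_t A t).
    rewrite /f (weighted_in w gen rN xt) /w.
    case: t {xt} => [[|[|[|[|[|//]]]]] ?] /=; rewrite ?normr1 //.
      by rewrite normrN gtr0_norm.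
    exact: le_trans w4_le c_le1.
  by rewrite /f weighted_out // normr0.
pose e := widen_ord (leqnSn 4).
have prod_w : \prod_t w (e t) = - c.
  by rewrite !big_ord_recl big_ord0 /w /= !mul1r mulr1.
have prod_w' : \prod_(t | t != ord_max) w t = - c.
  rewrite big_mkcond big_ord_recr /= mulr1 -prod_w; apply: eq_bigr => t _.
  by rewrite -val_eqE /= ltn_eqF.
pose S0 := [set s t | t : 'I_4].
(* [B1] bounds the moments of 4-element sets whose triples are all determined, [B2] those of sets
   with an independent triple. *)
pose B1 := #|V|%:R ^- 2 * \sum_x f x ^+ 4.
pose B2 := (#|\bigcup_t A t|%:R / #|V|%:R) ^+ 3 : R.
have B1_ge0 : 0 <= B1.
  by rewrite mulr_ge0 ?invr_ge0 ?exprn_ge0 ?sumr_ge0 // => x _; rewrite exprn_even_ge0.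
have B2_ge0 : 0 <= B2 by rewrite exprn_ge0 // divr_ge0.
have moment_le (S : {set 'I_k}) : #|S| == 4%N -> moment L f S <= B1 + B2.
  move=> /eqP cS.
  have [all_det|] := boolP [forall i in S, forall j in S, forall l in S,
      [&& i != j, i != l & j != l] ==> determined L i j l].
    apply: (le_trans (y := B1)); last by rewrite lerDl.
    apply: moment_determined_le => //; first by rewrite prod_w' oppr_le0 ltW.
    move=> i j l iS jS lS ij il jl.
    have /forall_inP/(_ i iS)/forall_inP/(_ j jS)/forall_inP/(_ l lS) := all_det.
    by rewrite ij il jl.
  move=> /forall_inPn[i iS /forall_inPn[j jS /forall_inPn[l lS]]].
  rewrite negb_imply => /andP[/and3P[ij _ _] undet].
  apply: (le_trans (y := B2)); last by rewrite lerDr.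
  apply: (@moment_undetermined_le _ _ _ _ _ L f _ S i j l) => //.
    by move=> x; apply: weighted_out.
  exact: triple_independent (ind i j ij) undet.
have moment_S0 : moment L f S0 <= B1 + B2 - c * r%:R ^+ 3 * #|V|%:R ^- 2.
  have eE (t : nat) : (t < 4)%N -> e (inord t) = t :> nat by move=> t4; rewrite /= inordK.
  have W_le0 : \prod_t w (e t) <= 0 by rewrite prod_w oppr_le0 ltW.
  have cover s' : C (e (inord 0)) s' != 0 \/ C (e (inord 1)) s' != 0.
    rewrite /C /coef !eE //.
    case: s' => [[|[|[|//]]] ?] /=; rewrite ?oppr_eq0 ?invr_eq0; by [left|right].
  have CE t s' : C (e t) s' = nth 0 [:: 1; 0; a; a * u] t * C (e (inord 0)) s' +
                             nth 0 [:: 0; 1; b; b * v] t * C (e (inord 1)) s'.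
    rewrite /C /coef !eE //.
    by case: t => [[|[|[|[|//]]]] ?]; case: s' => [[|[|[|//]]] ?] /=; field;
      rewrite ?a0 ?b0.
  have := moment_transversal_le ind gen rN W_le0 s_inj det cover CE (rowE (3 * N)%N).
  rewrite prod_w => /le_trans; apply.
  rewrite mulrDr -/f -/V -/B1 mulNr mulrN natrX [_ * (c * _)]mulrC.
  by rewrite lerD2r lerDl.
have cS0 : #|S0| == 4%N by rewrite card_imset // card_ord.
have avg_f : avg [set: 'rV[F]_(3 * N)] f = 0.
  by rewrite /avg (eq_bigl xpredT) ?sumf ?mulr0 // => x; rewrite inE.
have total : \sum_(S : {set 'I_k} | #|S| == 4%N) moment L f S <=
    K%:R * (B1 + B2) - c * r%:R ^+ 3 * #|V|%:R ^- 2.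
  rewrite (bigD1 S0) //=.
  (* Every subset other than [S0], whatever its size, is charged the nonnegative amount
     [B1 + B2]. *)
  apply: (@le_trans _ _ (B1 + B2 - c * r%:R ^+ 3 * #|V|%:R ^- 2 +
      \sum_(S : {set 'I_k} | S != S0) (B1 + B2))).
    apply: lerD => //; rewrite [leRHS](bigID (fun S : {set 'I_k} => #|S| == 4%N)) /=.
    rewrite -[leLHS]addr0 lerD ?sumr_ge0 // => [|S _]; last exact: addr_ge0.
    rewrite [leLHS](eq_bigl (fun S : {set 'I_k} => (S != S0) && (#|S| == 4%N))) => [|S].
      by apply: ler_sum => S /andP[_ /moment_le].
    by rewrite andbC.
  rewrite addrAC lerD2r mulr_natl.
  have <- : \sum_(S : {set 'I_k}) (B1 + B2) = (B1 + B2) *+ K by rewrite sumr_const.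
  by rewrite [leRHS](bigD1 S0).
have supp_le : #|\bigcup_t A t|%:R <= 5 * r%:R ^+ 3 :> R.
  rewrite -natrX -natrM ler_nat; have := card_bigcup_le (fun t => card_cluster_le r N (C t)).
  by rewrite card_ord.
have B2_le : B2 <= #|V|%:R ^- 2 * ((5 * r%:R ^+ 3) ^+ 3 / #|V|%:R).
  have -> : #|V|%:R ^- 2 * ((5 * r%:R ^+ 3) ^+ 3 / #|V|%:R) =
      (5 * r%:R ^+ 3 / #|V|%:R) ^+ 3 :> R by field; rewrite gt_eqF.
  by rewrite lerXn2r ?nnegrE ?divr_ge0 ?mulr_ge0 // ler_wpM2r ?invr_ge0.
have B1_le : B1 <= #|V|%:R ^- 2 * (3 * r%:R ^+ 2 + 2 * (c ^+ 4 * r%:R ^+ 3)).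
  by rewrite ler_wpM2l ?invr_ge0 ?exprn_ge0.
apply: (@uncommon_of_moments R F m k (3 * N) 4 L f) => //.
- by apply: leq_trans (leq_trans r_gt0 rN) _; rewrite leq_pmull.
(* The only even order below 4 is 2, where pairwise independence and mean zero make every moment
   vanish. *)
- move=> i /andP[i0 i4] even_i; have -> : i = 2%N by case: i i0 i4 even_i => [|[|[|[|]]]].
  rewrite big1 // => S /cards2P[p [q [pq ->]]].
  by rewrite moment_pair_independent ?avg_f ?expr0n //; apply: ind.
apply: le_lt_trans total _.
have rE : r%:R = 24 * K%:R ^+ 2 :> R by rewrite /r natrM natrX.
have := leading_term_negative K_ge1 (erefl c) rE V_gt0 V_ge.
have Vm2 : 0 < #|V|%:R ^- 2 :> R by rewrite invr_gt0 exprn_gt0.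
rewrite -(pmulr_rlt0 _ Vm2); apply: le_lt_trans.
rewrite mulrBr [_ * (c * _)]mulrC lerD2r mulrCA ler_wpM2l //.
by rewrite mulrDr lerD.
Qed.

Theorem theorem1p1 (R : realType) (F : finFieldType) (m k : nat)
  (L : 'M[F]_(m, k)) (hq : odd #|F|) (hm : (2 <= m)%N) (hmk : (m < k)%N)
  (hsys : is_system L) (hirr : irredundant L)
  (hind : exists L' : 'M[F]_(2, 4), is_system L' /\ induces L L') :
  uncommon R L.
Proof.
have [/existsP[[[i j] c] /and4P[/= ij c0 nzi prop]]|nprop] :=
    boolP [exists p : 'I_k * 'I_k * F, [&& p.1.1 != p.1.2, p.2 != 0,
      ~~ zero_var L p.1.1 & proportional L p.1.1 p.1.2 p.2]].
  exact: uncommon_of_proportional hirr ij c0 nzi prop.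
have nprop' i j c : i != j -> c != 0 -> ~~ zero_var L i -> ~~ proportional L i j c.
  move=> ij c0 nzi; apply: contra nprop => prop.
  by apply/existsP; exists (i, j, c); rewrite ij c0 nzi.
have [/existsP[i zi]|/existsPn nz] := boolP [exists i, zero_var L i].
  by apply: uncommon_of_zero_var hirr _ zi nprop'; apply: leq_trans hmk; apply: ltnW.
(* Ratio 0 is excluded separately, as it would make variable [j] vanish. *)
have ind i j : i != j -> independent L (pair_index i j).
  move=> ij; apply: pair_independent => // c.
  have [->|c0] := eqVneq c 0; last exact: nprop'.
  by apply: contra (@proportional0 _ _ _ _ _ _) (nz j).
have [L' [sysL' [s s_inj LL']]] := hind.
apply: (uncommon_of_independent ind s_inj) => p p' q pp' _ _.
by apply: (subsystem_determined _ sysL' LL'); apply: ind; rewrite (inj_eq s_inj).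
Qed.
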